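(* Let $T\subset\mathbb{R}^3$ be a (nondegenerate) tetrahedron with barycentric coordinates $\lambda_1,\dots,\lambda_4$, and define $$P_3^-(T):=P_2(T)+\operatorname{span}\{\lambda_1^2\lambda_2,\ \lambda_2^2\lambda_3,\ \lambda_3^2\lambda_1\},$$ $$P_4^-(T):=P_3(T)+\operatorname{span}\{\lambda_1^2\lambda_3\lambda_4,\ \lambda_2^2\lambda_4\lambda_1,\ \lambda_3^2\lambda_1\lambda_2,\ \lambda_4^2\lambda_2\lambda_3,\ \lambda_1\lambda_2^3\}.$$ For $k\in\{2,3\}$, any function $v\in P_{k+1}^-(T)$ is uniquely determined by the degrees of freedom $$\int_F v\,q\,ds\quad\text{for all } q\in P_{k-1}(F),\ F\in\mathcal{F}(T),\qquad\text{and}\qquad \int_T v\,dx.$$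
   Context: $P_m(S)$ denotes the space of real polynomials of degree at most $m$ on $S$ (for $S$ a tetrahedron or a triangular face). $\mathcal{F}(T)$ is the set of the four faces of $T$. ''Uniquely determined by the degrees of freedom'' is meant in the usual finite element sense of unisolvence: letting $q$ run through a basis of $P_{k-1}(F)$ for each of the four faces $F$, for every prescribed choice of values of the resulting functionals together with $\int_T v\,dx$ there is exactly one $v\in P_{k+1}^-(T)$ taking these values. *)

(* Defs.v *)
(* The notations of multinomials clash with those of
   MathComp-Analysis, hence the filtered import of mpoly. *)
From HB Require Import structures.
From mathcomp Require Import all_boot all_order all_algebra.
From mathcomp Require Import all_classical all_reals all_analysis.
From mathcomp Require Import -(notations) monalg mpoly.
Set Implicit Arguments.
Unset Strict Implicit.
Unset Printing Implicit Defensive.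
Import Order.TTheory GRing.Theory Num.Theory.
Import numFieldNormedType.Exports.
Local Open Scope classical_set_scope.
Local Open Scope ring_scope.

Section Geometry.
Variable R : realType.
Local Notation V := ('rV[R]_3).

Definition conv_hull n (b : 'I_n -> V) : set V :=
  [set \sum_i t i *: b i | t in
    [set t : 'I_n -> R | (forall i, 0 <= t i) /\ \sum_i t i = 1]].

(* The rows are the edge vectors issuing from the vertex b 0. *)
Definition edges n (b : 'I_n.+1 -> V) : 'M[R]_(n, 3) :=
  \matrix_i (b (lift ord0 i) - b ord0).

Definition nondegenerate_simplex n (b : 'I_n.+1 -> V) : bool := row_free (edges b).

(* Vertices of the face opposite to the vertex a i. *)
Definition face_vertices (a : 'I_4 -> V) (i : 'I_4) : 'I_3 -> V :=
  fun j => a (lift i j).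

Definition barycentric (a : 'I_4 -> V) (lam : 'I_4 -> V -> R) : Prop :=
  forall x : V, \sum_i lam i x = 1 /\ \sum_i lam i x *: a i = x.

End Geometry.

Section Integrals.
Variable R : realType.
Local Notation V := ('rV[R]_3).
Local Notation leb := (@lebesgue_measure R).

(* The library has no Lebesgue measure on row vectors: R^3 is identified
   with R * R * R, which carries the product measure. *)
Definition vec3 (z : R * R * R) : V :=
  \row_(i < 3) [:: z.1.1; z.1.2; z.2]`_i.

Definition volume_integral (D : set V) (f : V -> R) : R :=
  \int[((leb \x leb) \x leb)%E]_(z in vec3 @^-1` D) f (vec3 z).

(* Surface integral over the triangle with vertices b 0, b 1, b 2: the affine
   parametrization from the reference triangle has the constant area element
   sqrt (det (E E^T)), the norm of the cross product of the two edges. *)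
Definition triangle_integral (b : 'I_3 -> V) (f : V -> R) : R :=
  Num.sqrt (\det (edges b *m (edges b)^T)) *
  \int[(leb \x leb)%E]_(z in [set z : R * R |
                          [/\ 0 <= z.1, 0 <= z.2 & z.1 + z.2 <= 1]])
    f (b 0 + z.1 *: (b 1 - b 0) + z.2 *: (b 2 - b 0)).

End Integrals.

Section FunctionSpaces.
Variable R : realType.
Local Notation V := ('rV[R]_3).

Definition lin_span (s : seq (V -> R)) : set (V -> R) :=
  [set \sum_(i < size s) c i *: s`_i | c in [set: 'I_(size s) -> R]].

Definition is_basis (W : set (V -> R)) (s : seq (V -> R)) : Prop :=
  (forall c : 'I_(size s) -> R,
     \sum_(i < size s) c i *: s`_i = 0 -> forall i, c i = 0)
  /\ lin_span s = W.

(* A function on S is represented by its extension by zero outside S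
   ([point] is 0 in R), so that equality of functions on S is Leibniz
   equality.  msize is the total degree plus one. *)
Definition poly_space (m : nat) (S : set V) : set (V -> R) :=
  [set (fun x : V => meval (x 0) p) \_ S | p in
    [set p : mpoly 3 R | (msize p <= m.+1)%N]].

(* The coordinates are numbered 0, 1, 2, 3 instead of 1, 2, 3, 4. *)
Definition enrichment (lam : 'I_4 -> V -> R) (m : nat) : seq (V -> R) :=
  let l1 := lam 0 in let l2 := lam 1 in let l3 := lam 2 in let l4 := lam 3 in
  match m with
  | 3%N => [:: l1 ^+ 2 * l2; l2 ^+ 2 * l3; l3 ^+ 2 * l1]
  | 4%N => [:: l1 ^+ 2 * l3 * l4; l2 ^+ 2 * l4 * l1; l3 ^+ 2 * l1 * l2;
               l4 ^+ 2 * l2 * l3; l1 * l2 ^+ 3]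
  | _ => [::]
  end.

(* The space P_m^-(T); only m = 3 and m = 4 are meaningful. *)
Definition poly_minus (m : nat) (T : set V) (lam : 'I_4 -> V -> R) :
    set (V -> R) :=
  [set u + w | u in poly_space m.-1 T
             & w in lin_span [seq g \_ T | g <- enrichment lam m]].

End FunctionSpaces.

(* Main.v *)
Require Import Defs.
From HB Require Import structures.
From Stdlib Require Import BinInt.
From mathcomp Require Import all_boot all_order all_algebra.
From mathcomp Require Import all_classical all_reals all_analysis.
From mathcomp Require Import -(notations) monalg mpoly.
From mathcomp Require Import measurable_realfun zify ssrZ ring lra.
Import Order.TTheory GRing.Theory Num.Theory.
Import numFieldNormedType.Exports.
Import ssrZ.Instances.
Local Open Scope classical_set_scope.
Local Open Scope ring_scope.

(** Both sides of the interpolation problem are finite dimensional of the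
    same dimension: 13 = 4 * 3 + 1 for k = 2 and 25 = 4 * 6 + 1 for k = 3. In
    suitable bases the matrix of the degrees of freedom is, up to a nonzero
    factor in each row, a matrix of integers that depends on k only, and
    unisolvence says that this matrix is invertible.

    Bases. Since the barycentric coordinates l_i are affine and sum to 1, the
    homogeneous monomials of degree m in l_0, ..., l_3 span the polynomials of
    degree at most m in the Cartesian coordinates [poly_spaceE]. On the face
    where l_i = 0 the monomials without l_i are enough [poly_space_faceE], and
    P_{k+1}^- is spanned by the monomials of degree k and the enrichment,
    whose members are monomials too [poly_minusE].

    Matrix. All moments are integrals of monomials l^e over a face or over T.
    By Dirichlet's formula they are e! / (|e| + 2)! or e! / (|e| + 3)!, with
    e! the product of the factorials of the exponents, up to a factor that
    depends on the simplex only [face_moment, volume_moment]. For a face the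
    factor is the area element of the surface integral, nonzero because the
    Gram determinant of independent edges is positive. For T it comes from
    the affine change of variables to the reference tetrahedron: Lebesgue
    measure transported by an affine bijection is translation invariant, so by
    uniqueness of Haar measure it is a positive multiple of Lebesgue measure
    [integral_affine].

    Invertibility. After clearing denominators the matrix has integer entries,
    and Gaussian elimination, proved sound for real solutions of an integer
    system [full_column_rankP], is run on it [dof_matrix_rank].

    The prescribed values refer to arbitrary bases of the spaces P_{k-1}(F),
    whereas the matrix uses monomials; [is_basis_transfer] passes from
    one family of test functions to the other. *)

(** * Elimination over the integers *)

Section Elimination.

Definition ZtoR (R : realType) (z : Z) : R := (int_of_Z z)%:~R.

Fixpoint dot (R : realType) (r : seq Z) (x : seq R) : R :=
  match r, x with
  | a :: r', b :: x' => ZtoR R a * b + dot R r' x'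
  | _, _ => 0
  end.

(** The combination of the rows [p] and [r] in which the first unknown cancels,
    written for the remaining unknowns. *)
Definition eliminate_head (p r : seq Z) : seq Z :=
  [seq Z.sub (Z.mul (head Z0 p) ab.2) (Z.mul (head Z0 r) ab.1)
     | ab <- zip (behead p) (behead r)].

(** Without this division the entries could double their length with each
    eliminated unknown. The test makes soundness independent of any property
    of the gcd. *)
Definition primitive_row (r : seq Z) : seq Z :=
  let d := foldr Z.gcd Z0 r in
  let r' := [seq Z.div a d | a <- r] in
  if (d != Z0) && ([seq Z.mul d a | a <- r'] == r) then r' else r.

(** Gaussian elimination; the meaning of a positive answer is
    [full_column_rankP]. *)
Fixpoint full_column_rank (n : nat) (rows : seq (seq Z)) : bool :=
  if n is n'.+1 then
    if [seq r <- rows | head Z0 r != Z0] is p :: ps then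
      full_column_rank n' ([seq primitive_row (eliminate_head p r) | r <- ps] ++
                  [seq behead r | r <- rows & head Z0 r == Z0])
    else false
  else true.

Variable R : realType.

Lemma ZtoR_mul a b : ZtoR R (Z.mul a b) = ZtoR R a * ZtoR R b.
Proof. by rewrite /ZtoR -intrM -rmorphM. Qed.

Lemma ZtoR_sub a b : ZtoR R (Z.sub a b) = ZtoR R a - ZtoR R b.
Proof. by rewrite /ZtoR -intrB -rmorphB. Qed.

Lemma ZtoR_eq0 a : (ZtoR R a == 0) = (a == Z0).
Proof.
rewrite /ZtoR intr_eq0 -[X in _ == X](rmorph0 int_of_Z).
by rewrite (inj_eq (can_inj int_of_ZK)).
Qed.

Lemma ZtoR_nat n : ZtoR R (Z.of_nat n) = n%:R.
Proof. by rewrite /ZtoR (_ : int_of_Z _ = n%:Z) //; lia. Qed.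

Lemma dotE (r : seq Z) (x : seq R) : size r = size x ->
  dot R r x = \sum_(i < size x) ZtoR R (nth Z0 r i) * x`_i.
Proof.
elim: r x => [|a r IH] [|b x] //=; first by rewrite big_ord0.
by case=> /IH ->; rewrite big_ord_recl.
Qed.

Lemma dot_eliminate_head p r (x : seq R) (b : R) :
  size p = (size x).+1 -> size r = (size x).+1 ->
  dot R p (b :: x) = 0 -> dot R r (b :: x) = 0 -> dot R (eliminate_head p r) x = 0.
Proof.
case: p r => [|c p] [|d r] //= [sp] [sr] p0 r0.
suff -> : dot R (eliminate_head (c :: p) (d :: r)) x =
    ZtoR R c * dot R r x - ZtoR R d * dot R p x.
  by rewrite -(addr0_eq p0) -(addr0_eq r0); ring.
rewrite /eliminate_head /= {p0 r0}; elim: x p r sp sr => [|y x IH] [|e p] [|f r] //=.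
  by rewrite !mulr0 subrr.
move=> [sp] [sr]; rewrite IH // ZtoR_sub !ZtoR_mul; ring.
Qed.

Lemma size_eliminate_head n p r : size p = n.+1 -> size r = n.+1 ->
  size (eliminate_head p r) = n.
Proof. by move=> sp sr; rewrite size_map size_zip !size_behead sp sr minnn. Qed.

Lemma size_primitive_row r : size (primitive_row r) = size r.
Proof. by rewrite /primitive_row; case: ifP => // _; rewrite size_map. Qed.

Lemma dot_scale d r (x : seq R) :
  dot R [seq Z.mul d a | a <- r] x = ZtoR R d * dot R r x.
Proof.
elim: r x => [|a r IH] [|b x] //=; rewrite ?mulr0 //.
by rewrite IH ZtoR_mul mulrDr mulrA.
Qed.

Lemma dot_primitive_row r (x : seq R) : dot R r x = 0 -> dot R (primitive_row r) x = 0.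
Proof.
rewrite /primitive_row /=; case: ifP => // /andP[d0 /eqP E].
by rewrite -{1}E dot_scale => /eqP; rewrite mulf_eq0 ZtoR_eq0 (negPf d0) => /eqP.
Qed.

(** The rows produced by an elimination step vanish on the tail of any solution
    of the original rows, so the tail is zero by induction; the pivot row then
    forces the head to be zero. *)
Lemma full_column_rankP n rows (x : seq R) :
  size x = n -> {in rows, forall r, size r = n} ->
  {in rows, forall r, dot R r x = 0} -> full_column_rank n rows -> x = nseq n 0.
Proof.
elim: n rows x => [|n IH] rows [|b x] //= [sx] srows rows0.
case E: [seq r <- rows | _] => [//|p ps] rk.
have mem_ps r : r \in p :: ps -> (r \in rows) && (head Z0 r != Z0).
  by rewrite -E mem_filter andbC.
have x0 : x = nseq n 0.
  apply: (IH _ _ sx _ _ rk) => r; rewrite mem_cat => /orP[] /mapP[s].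
  - move=> sps ->; rewrite size_primitive_row.
    have /andP[pr _] := mem_ps p (mem_head _ _).
    have /mem_ps/andP[sr _] : s \in p :: ps by rewrite inE sps orbT.
    by apply: size_eliminate_head; apply: srows.
  - by rewrite mem_filter => /andP[_ /srows ss] ->; rewrite size_behead ss.
  - move=> sps ->; apply: dot_primitive_row.
    have /andP[pr _] := mem_ps p (mem_head _ _).
    have /mem_ps/andP[sr _] : s \in p :: ps by rewrite inE sps orbT.
    by apply: (@dot_eliminate_head _ _ _ b); rewrite ?srows ?sx //; apply: rows0.
  - rewrite mem_filter => /andP[/eqP s0 sr] ->.
    move: (rows0 _ sr) s0; case: s {sr} => [|a s] //= + a0.
    by rewrite a0 /ZtoR rmorph0 mul0r add0r.
have /andP[pr p0] := mem_ps p (mem_head _ _).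
rewrite {}x0 in rows0 *; congr (_ :: _).
move: (rows0 _ pr) p0; case: p {E rk pr mem_ps} => [|a p] //=.
have -> : dot R p (nseq n 0) = 0.
  by elim: n p {IH sx srows rows0} => [|n IH] [|c p] //=; rewrite mulr0 add0r.
by rewrite addr0 -ZtoR_eq0 => /eqP; rewrite mulf_eq0 => /orP[->|/eqP].
Qed.

Lemma full_column_rank_unitmx n rows :
  size rows = n -> {in rows, forall r, size r = n} -> full_column_rank n rows ->
  (\matrix_(i < n, j < n) ZtoR R (nth Z0 (nth [::] rows i) j)) \in unitmx.
Proof.
move=> srows size_row rk; rewrite -unitmx_tr -row_free_unit.
apply: inj_row_free => u uA.
have sx : size (mkseq (fun j => if insub j is Some j' then u 0 j' else 0) n) = n.
  by rewrite size_mkseq.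
have ux (j : 'I_n) :
    (mkseq (fun j => if insub j is Some j' then u 0 j' else 0) n)`_j = u 0 j.
  by rewrite nth_mkseq // valK.
move: (mkseq _ n) sx ux => x sx ux.
suff x0 : x = nseq n 0.
  by apply/rowP => j; rewrite -ux x0 nth_nseq ltn_ord mxE.
apply: (full_column_rankP _ _ _ sx size_row _ rk) => r rr.
rewrite dotE ?size_row // sx.
have ir : (index r rows < n)%N by rewrite -srows index_mem.
move/rowP/(_ (Ordinal ir)): uA; rewrite !mxE => uAr; rewrite -[RHS]uAr.
by apply: eq_bigr => j _; rewrite !mxE /= nth_index // ux mulrC.
Qed.

End Elimination.

(** * The rational linear system *)

(** Defined by recursion, rather than as a finite type of multi-indices, so that
    the lists reduce by computation. *)
Fixpoint exponents (n m : nat) : seq (seq nat) :=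
  if n is n'.+1 then
    flatten [seq [seq j :: e | e <- exponents n' (m - j)] | j <- iota 0 m.+1]
  else if m == 0%N then [:: [::]] else [::].

Lemma mem_exponents n m e :
  (e \in exponents n m) = (size e == n) && (sumn e == m).
Proof.
have expS p q : exponents p.+1 q =
    flatten [seq [seq j :: e | e <- exponents p (q - j)] | j <- iota 0 q.+1] by [].
elim: n m e => [|n IH] m [|j e].
- by case: m.
- by case: m.
- by rewrite expS; apply/negbTE/negP => /flatten_mapP[j _ /mapP[e _]].
- rewrite expS [size _]/= [sumn _]/= eqSS.
  apply/flatten_mapP/andP => [[i] | [/eqP se /eqP <-]].
    rewrite mem_iota add0n ltnS /= => im /mapP[f]; rewrite IH.
    by move=> /andP[/eqP sf /eqP sumf] [-> ->]; rewrite sf sumf subnKC.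
  exists j; first by rewrite mem_iota add0n /= ltnS leq_addr.
  by apply/mapP; exists e; rewrite ?IH ?se ?addKn ?eqxx.
Qed.

Lemma sumn_incr_nth e i : sumn (incr_nth e i) = (sumn e).+1.
Proof.
elim: e i => [|j e IH] i.
  by rewrite (_ : incr_nth [::] i = ncons i 0%N [:: 1%N]) ?sumn_ncons //; case: i.
by case: i => [|i] //=; rewrite IH addnS.
Qed.

Definition fact_seq (e : seq nat) : nat := foldr muln 1%N (map factorial e).

(** Dirichlet's value [fact_seq e / (sumn e + n)!] of the integral of the
    monomial with exponents [e] over the reference [n]-simplex, multiplied by [N!]. The
    falling factorial is the integer [N! / (sumn e + n)!]. *)
Definition scaled_moment (N n : nat) (e : seq nat) : nat :=
  N ^_ (N - (sumn e + n)) * fact_seq e.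

Definition add_seq (e f : seq nat) : seq nat :=
  [seq (p.1 + p.2)%N | p <- zip e f].

Definition enrichment_exponents (k : nat) : seq (seq nat) :=
  if k == 2%N then [:: [:: 2; 1; 0; 0]; [:: 0; 2; 1; 0]; [:: 1; 0; 2; 0]]%N
  else [:: [:: 2; 0; 1; 1]; [:: 1; 2; 0; 1]; [:: 1; 1; 2; 0]; [:: 0; 1; 1; 2];
          [:: 1; 3; 0; 0]]%N.

Definition trial_exponents k := exponents 4 k ++ enrichment_exponents k.

Definition test_exponents k (i : nat) := [seq e <- exponents 4 k.-1 | nth 0 e i == 0]%N.

(** The highest degree of a trial function times a test function is
    (k + 1) + (k - 1) = 2k, so (2k + 2)! is a common denominator of the face
    moments; for the volume it is (k + 1 + 3)!. A monomial that contains the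
    coordinate [i] vanishes on the face [i]. *)
Definition face_row k i g : seq Z :=
  [seq Z.of_nat (if nth 0 e i == 0 then scaled_moment (k.*2 + 2) 2 (add_seq e g) else 0)%N
     | e <- trial_exponents k].

Definition volume_row k : seq Z :=
  [seq Z.of_nat (scaled_moment (k + 4) 3 e) | e <- trial_exponents k].

(** [None] stands for the integral over the tetrahedron and [Some (i, j)] for
    the moment over the face [i] against its test monomial number [j]. *)
Definition dofs k : seq (option (nat * nat)) :=
  None :: [seq Some (i, j) | i <- iota 0 4, j <- iota 0 (size (test_exponents k i))].

Definition dof_row k (o : option (nat * nat)) : seq Z :=
  if o is Some (i, j) then face_row k i (nth [::] (test_exponents k i) j) else volume_row k.

Lemma mem_dofs k i j :
  (Some (i, j) \in dofs k) = (i < 4)%N && (j < size (test_exponents k i))%N.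
Proof.
rewrite /dofs in_cons orFb; apply/allpairsPdep/andP => [[i' [j' []]]|[i4 jk]].
  by rewrite !mem_iota !add0n => i4 jk [-> ->].
by exists i, j; rewrite !mem_iota !add0n.
Qed.

(** * Dirichlet integrals over the reference simplices *)

Section ProductMeasure.
Context d1 d2 (T1 : measurableType d1) (T2 : measurableType d2) (R : realType).
Variables (m1 : {sigma_finite_measure set T1 -> \bar R})
          (m2 : {sigma_finite_measure set T2 -> \bar R}).

Lemma sigma_finite_product : sigma_finite setT (m1 \x m2)%E.
Proof.
have /sigma_finiteP[F [coverF ndF finF]] := sigma_finiteT m1.
have /sigma_finiteP[G [coverG ndG finG]] := sigma_finiteT m2.
exists (fun n => F n `*` G n) => [|n].
  apply/esym; rewrite -subTset => -[x y] _.
  have [i _ Fx] : (\bigcup_i F i) x by rewrite -coverF.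
  have [j _ Gy] : (\bigcup_i G i) y by rewrite -coverG.
  exists (maxn i j) => //; split => /=.
    by apply: (subsetPset _ _ (ndF _ _ (leq_maxl i j))).
  by apply: (subsetPset _ _ (ndG _ _ (leq_maxr i j))).
have [[mF Foo] [mG Goo]] := (finF n, finG n).
split; first exact: measurableX.
by rewrite product_measure1E // lte_mul_pinfty // ge0_fin_numE.
Qed.

(** Packaged as a sigma-finite measure, so that products can be iterated and
    Tonelli's theorem applies to triples. *)
Definition product_sigma_finite : {sigma_finite_measure set (T1 * T2)%type -> \bar R} :=
  HB.pack_for {sigma_finite_measure set (T1 * T2)%type -> \bar R} (m1 \x m2)%E
    (Measure_isSigmaFinite.Build _ _ _ (m1 \x m2)%E sigma_finite_product).

End ProductMeasure.

Arguments product_sigma_finite {d1 d2 T1 T2 R}.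

Section Beta.
Variable R : realType.
Local Notation leb := (@lebesgue_measure R).

Lemma integral_deriv_horner (p : {poly R}) (s : R) : 0 <= s ->
  (\int[leb]_(x in `[0%R, s]) (p^`().[x])%:E)%E = (p.[s] - p.[0])%:E.
Proof.
rewrite le_eqVlt => /predU1P[<-|s0].
  by rewrite set_itv1 integral_set1 subrr.
rewrite (@continuous_FTC2 _ _ (horner p)) //.
- by apply: continuous_in_subspaceT => x _; exact: continuous_horner.
- split.
  + by move=> x _; exact: derivable_horner.
  + by apply: cvg_at_right_filter; exact: continuous_horner.
  + by apply: cvg_at_left_filter; exact: continuous_horner.
- by move=> x _; rewrite derivE.
Qed.

(** Integration by parts in [d], performed on antiderivatives: the boundary
    term [X^(c+1) (s - X)^(d+1)] vanishes at both ends. *)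
Lemma beta_antiderivative (s : R) c d : exists q : {poly R},
  [/\ q^`() = 'X^c * (s%:P - 'X) ^+ d, q.[0] = 0 &
      q.[s] = (c`! * d`!)%:R / ((c + d).+1)`!%:R * s ^+ (c + d).+1].
Proof.
have nz n : n.+1%:R != 0 :> R by rewrite pnatr_eq0.
have fz n : n`!%:R != 0 :> R by rewrite pnatr_eq0 -lt0n fact_gt0.
have cz n : (n.+1%:R^-1)%:P * (n.+1%:R)%:P = 1 :> {poly R}.
  by rewrite -polyCM mulVf.
have dX n : ('X^(n.+1))^`() = (n.+1%:R)%:P * 'X^n :> {poly R}.
  by rewrite derivXn polyC_natr mulr_natl.
elim: d c => [|d IH] c.
  exists (c.+1%:R^-1 *: 'X^(c.+1)); split.
  - by rewrite derivZ dX -mul_polyC mulrA cz mul1r expr0 mulr1.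
  - by rewrite hornerZ hornerXn expr0n mulr0.
  - rewrite hornerZ hornerXn addn0 fact0 muln1 factS natrM.
    by congr (_ * _); field; rewrite nat1r fz nz.
have [q [q' q0 qs]] := IH c.+1.
exists (c.+1%:R^-1 *: ('X^(c.+1) * (s%:P - 'X) ^+ d.+1 + d.+1%:R *: q)); split.
- rewrite derivZ derivD derivM dX derivZ q' deriv_exp derivB derivC derivX.
  rewrite sub0r /= -!mul_polyC -[_ *+ d.+1]mulr_natl -polyC_natr.
  transitivity ((c.+1%:R^-1)%:P * (c.+1%:R)%:P * ('X^c * (s%:P - 'X) ^+ d.+1)).
    by ring.
  by rewrite cz mul1r.
- by rewrite hornerZ hornerD hornerM hornerXn expr0n mul0r hornerZ q0 mulr0 addr0 mulr0.
- rewrite hornerZ hornerD hornerM hornerXn hornerZ qs horner_exp hornerD hornerN.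
  rewrite hornerC hornerX.
  rewrite subrr expr0n mulr0 add0r addSnnS mulrA mulrA; congr (_ * _).
  rewrite !factS !natrM; field.
  by rewrite fz !nat1r -natrD nat1r !nz.
Qed.

Lemma integral_beta (s : R) c d : 0 <= s ->
  (\int[leb]_(x in `[0%R, s]) (x ^+ c * (s - x) ^+ d)%:E)%E =
  ((c`! * d`!)%:R / ((c + d).+1)`!%:R * s ^+ (c + d).+1)%:E.
Proof.
move=> s0; have [q [q' q0 qs]] := beta_antiderivative s c d.
have := integral_deriv_horner q _ s0; rewrite q0 subr0 qs q' => <-.
apply: eq_integral => x _.
by rewrite hornerM hornerXn horner_exp hornerD hornerN hornerC hornerX.
Qed.

Lemma measurable_subgraph d (T : measurableType d) (D : set T) (s : T -> R) :
  measurable D -> measurable_fun setT s ->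
  measurable [set z : T * measurableTypeR R | D z.1 /\ (0 <= (z.2 : R) <= s z.1)].
Proof.
move=> mD ms.
have -> : [set z : T * measurableTypeR R | D z.1 /\ (0 <= (z.2 : R) <= s z.1)] =
   (fst @^-1` D) `&` [set z | 0 <= z.2 :> R] `&` [set z | z.2 <= s z.1 :> R].
  apply/seteqP; split=> z /=; first by case=> Dz /andP[].
  by case=> [[Dz z0] zs]; split=> //; apply/andP.
have msnd : measurable_fun [set: T * measurableTypeR R] (fun z => z.2 : R).
  exact: measurable_snd.
apply: measurable_fun_le; [|exact: measurable_funTS|apply: measurable_funTS].
  apply: measurable_fun_le; [|exact: measurable_cst|exact: measurable_funTS].
  by rewrite -[X in measurable X]setTI; apply: measurable_fst.
exact: (measurableT_comp ms measurable_fst).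
Qed.

(** One step of Dirichlet's formula: by Tonelli the last variable, which runs
    through [0, s x], is integrated first and leaves a beta integral. *)
Lemma integral_subgraph d (T : measurableType d)
    (mu : {sigma_finite_measure set T -> \bar R}) (D : set T) (w s : T -> R) m n :
  measurable D -> measurable_fun setT w -> measurable_fun setT s ->
  (forall x, D x -> 0 <= w x /\ 0 <= s x) ->
  (\int[product_sigma_finite mu leb]_(z in [set z : T * measurableTypeR R |
                                          D z.1 /\ (0 <= (z.2 : R) <= s z.1)%R])
     (w z.1 * (z.2 ^+ m * (s z.1 - z.2) ^+ n))%:E =
  ((m`! * n`!)%:R / ((m + n).+1)`!%:R)%:E *
    \int[mu]_(x in D) (w x * s x ^+ (m + n).+1)%:E)%E.
Proof.
move=> mD mw ms ws0.
set S := [set z | _].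
have mfst (f : T -> R) : measurable_fun setT f ->
    measurable_fun [set: T * measurableTypeR R] (fun z => f z.1).
  by move=> mf; exact: (measurableT_comp mf measurable_fst).
have msnd : measurable_fun [set: T * measurableTypeR R] (fun z => z.2 : R).
  exact: measurable_snd.
have mS : measurable (S : set (T * measurableTypeR R)) by exact: measurable_subgraph.
pose g (z : T * measurableTypeR R) : \bar R := (w z.1 * (z.2 ^+ m * (s z.1 - z.2) ^+ n))%:E.
have mg : measurable_fun setT g.
  apply/measurable_EFinP; apply: measurable_funM; first exact: mfst.
  apply: measurable_funM; first exact: measurable_funX.
  by apply: measurable_funX; apply: measurable_funB => //; exact: mfst.
have g0 z : S z -> (0 <= g z)%E.
  move=> [/ws0[w0 s0] /andP[z0 zs]]; rewrite lee_fin mulr_ge0 // mulr_ge0 //.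
    exact: exprn_ge0.
  by rewrite exprn_ge0 // subr_ge0.
rewrite integral_mkcond fubini_tonelli1; first last.
- by move=> z; rewrite patchE; case: ifP => // /[!inE] /g0.
- by apply/(measurable_restrictT _ mS); exact: measurable_funTS.
rewrite [in RHS]integral_mkcond -ge0_integralZl_EFin //; first last.
- apply/(measurable_restrictT _ mD)/measurable_funTS/measurable_EFinP.
  by apply: measurable_funM => //; exact: measurable_funX.
- move=> x _; rewrite patchE; case: ifP => // /[!inE] /ws0[w0 s0].
  by rewrite lee_fin mulr_ge0 // exprn_ge0.
apply: eq_integral => x _; rewrite /fubini_F /= [in RHS]patchE.
have [Dx|nDx] := pselect (D x); last first.
  rewrite memNset // mule0; apply: integral0_eq => y _.
  by rewrite patchE memNset // => -[].
rewrite mem_set //.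
have [w0 s0] := ws0 _ Dx.
transitivity (\int[leb]_(y in `[0%R, s x])
    ((w x)%:E * (y ^+ m * (s x - y) ^+ n)%:E))%E.
  rewrite [RHS]integral_mkcond; apply: eq_integral => y _; rewrite !patchE.
  have -> : ((x, y) \in S) = (y \in `[0%R, s x]%classic).
    apply/idP/idP; rewrite !inE /S /= in_itv /=; by [case|].
  by case: ifP.
rewrite ge0_integralZl_EFin //.
- by rewrite integral_beta // -!EFinM; congr (_%:E); ring.
- move=> y /=; rewrite in_itv /= => /andP[y0 ys].
  by rewrite lee_fin mulr_ge0 // exprn_ge0 // subr_ge0.
- apply/measurable_EFinP/measurable_funTS; apply: measurable_funM.
    exact: exprn_measurable.
  by apply: measurable_funX; apply: measurable_funB.
Qed.

End Beta.

Section Dirichlet.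
Variable R : realType.
Local Notation leb := (@lebesgue_measure R).
Local Notation plane := (product_sigma_finite leb leb).
Local Notation space := (product_sigma_finite plane leb).
Local Notation line := (measurableTypeR R).

Definition ref_triangle : set (line * line) :=
  [set z | [/\ 0 <= z.1, 0 <= z.2 & z.1 + z.2 <= 1 :> R]].

(** Described as a region over the triangle, the form in which
    [integral_subgraph] applies. *)
Definition ref_tetrahedron : set (line * line * line) :=
  [set z | ref_triangle z.1 /\ (0 <= (z.2 : R) <= 1 - z.1.1 - z.1.2)].

Lemma ref_triangleE :
  ref_triangle = [set z | `[0%R, 1%R]%classic z.1 /\ (0 <= (z.2 : R) <= 1 - z.1)].
Proof.
apply/seteqP; split=> -[x y] /=; rewrite /ref_triangle /= in_itv /=.
  by case=> x0 y0 xy; split; lra.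
by case=> /andP[x0 x1] /andP[y0 xy]; split; lra.
Qed.

Lemma measurable_ref_triangle : measurable ref_triangle.
Proof.
rewrite ref_triangleE.
apply: (@measurable_subgraph R _ line `[0%R, 1%R]%classic (fun x => 1 - x : R)) => //.
exact: measurable_funB.
Qed.

Lemma measurable_ref_tetrahedron : measurable ref_tetrahedron.
Proof.
apply: (@measurable_subgraph R _ (line * line)%type ref_triangle
  (fun z => 1 - z.1 - z.2 : R)).
  exact: measurable_ref_triangle.
apply: measurable_funB; last exact: measurable_snd.
by apply: measurable_funB => //; exact: measurable_fst.
Qed.

Lemma fact_fraction_cancel (m n p q : nat) :
  m%:R / q`!%:R * ((n * q`!)%:R / p%:R) = (n * m)%:R / p%:R :> R.
Proof.
have qz : q`!%:R != 0 :> R by rewrite pnatr_eq0 -lt0n fact_gt0.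
by rewrite !natrM; move: (q`!%:R) (p%:R^-1) qz => x y x0; field.
Qed.

(** The weights x, y and 1 - x - y are the barycentric coordinates, so this is
    the moment of an arbitrary barycentric monomial. *)
Lemma dirichlet_triangle a b c :
  (\int[plane]_(z in ref_triangle)
     (z.1 ^+ a * (z.2 ^+ b * (1 - z.1 - z.2) ^+ c))%:E)%E =
  ((a`! * (b`! * c`!))%:R / (a + b + c).+2`!%:R)%:E :> \bar R.
Proof.
rewrite ref_triangleE.
rewrite (@integral_subgraph _ _ line _ _ (fun x => x ^+ a : R) (fun x => 1 - x : R)) //.
- under eq_integral do rewrite /=.
  by rewrite integral_beta // -EFinM expr1n mulr1 fact_fraction_cancel !addnS addnA.
- exact: measurable_funB.
- move=> x /=; rewrite in_itv /= => /andP[x0 x1].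
  by rewrite exprn_ge0 // subr_ge0.
Qed.

Lemma dirichlet_tetrahedron a b c d :
  (\int[space]_(z in ref_tetrahedron)
     (z.1.1 ^+ a * z.1.2 ^+ b * (z.2 ^+ c * (1 - z.1.1 - z.1.2 - z.2) ^+ d))%:E)%E =
  ((a`! * (b`! * (c`! * d`!)))%:R / (a + b + c + d).+3`!%:R)%:E :> \bar R.
Proof.
rewrite (@integral_subgraph _ _ (line * line)%type plane ref_triangle
  (fun z => z.1 ^+ a * z.2 ^+ b : R) (fun z => 1 - z.1 - z.2 : R)) //.
- under eq_integral do rewrite -mulrA.
  rewrite dirichlet_triangle // -EFinM (mulnA a`!) fact_fraction_cancel.
  by rewrite -mulnA !addnS !addnA.
- exact: measurable_ref_triangle.
- apply: measurable_funM; apply: measurable_funX.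
    exact: measurable_fst.
  exact: measurable_snd.
- apply: measurable_funB; last exact: measurable_snd.
  by apply: measurable_funB => //; exact: measurable_fst.
- move=> z [x0 y0 xy]; rewrite mulr_ge0 ?exprn_ge0 //.
  by split=> //; rewrite -addrA -opprD subr_ge0.
Qed.

End Dirichlet.

(** * Affine changes of variables *)

Definition preserves_integral d (T : measurableType d) (R : realType)
    (mu : {measure set T -> \bar R}) (u : T -> T) : Prop :=
  measurable_fun setT u /\
  (forall f : T -> \bar R, measurable_fun setT f -> (forall x, 0 <= f x) ->
    \int[mu]_x f (u x) = \int[mu]_x f x)%E.

Arguments preserves_integral {d T R}.

Section TranslationInvariance.
Local Open Scope ereal_scope.

Lemma preserves_integral_lebesgue (R : realType) (t : R) :
  preserves_integral (@lebesgue_measure R)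
    ((fun x : R => (x + t)%R) : measurableTypeR R -> measurableTypeR R).
Proof.
have mu : measurable_fun [set: measurableTypeR R]
    ((fun x : R => (x + t)%R) : measurableTypeR R -> measurableTypeR R).
  by apply: (@measurable_funD _ (measurableTypeR R) R setT id (cst t)).
split=> // f mf f0.
rewrite -[LHS](@ge0_integral_pushforward _ _ _ _ _ _ mu _ setT) //.
apply: eq_measure_integral => A mA _.
apply/esym/lebesgue_measure_unique => // _ [[a b]] _ <-.
have E : (fun x => x + t)%R @^-1` `]a, b]%classic = `](a - t)%R, (b - t)%R]%classic.
  by apply/seteqP; split=> x /=; rewrite !in_itv /= ltrBlDr lerBrDr.
transitivity (@lebesgue_measure R `](a - t)%R, (b - t)%R]%classic); last by rewrite -E.
rewrite !lebesgue_measure_itv /= !lte_fin ltrD2r -!EFinB.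
by rewrite opprB addrA subrK.
Qed.

(** Tonelli: each factor is moved while the other variable is fixed. *)
Lemma preserves_integral_product d1 d2 (T1 : measurableType d1)
    (T2 : measurableType d2) (R : realType)
    (m1 : {sigma_finite_measure set T1 -> \bar R})
    (m2 : {sigma_finite_measure set T2 -> \bar R}) u1 u2 :
  preserves_integral m1 u1 -> preserves_integral m2 u2 ->
  preserves_integral (product_sigma_finite m1 m2) (fun z => (u1 z.1, u2 z.2)).
Proof.
move=> [mu1 H1] [mu2 H2].
have mu : measurable_fun [set: T1 * T2] (fun z => (u1 z.1, u2 z.2)).
  apply: measurable_fun_pair.
    exact: (measurableT_comp mu1 measurable_fst).
  exact: (measurableT_comp mu2 measurable_snd).
split=> // f mf f0.
rewrite [LHS]fubini_tonelli1 //; last exact: (measurableT_comp mf mu).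
rewrite [RHS]fubini_tonelli1 // /fubini_F /=.
transitivity (\int[m1]_x \int[m2]_y f (u1 x, y)).
  apply: eq_integral => x _.
  by rewrite -(H2 (fun y => f (u1 x, y))) //; exact: measurable_fun_pair2.
rewrite (H1 (fun x => \int[m2]_y f (x, y))) //.
- exact: measurable_fun_fubini_tonelli_F.
- by move=> x; exact: integral_ge0.
Qed.

End TranslationInvariance.

Section AffineChange.
Local Open Scope ereal_scope.
Variable R : realType.
Local Notation leb := (@lebesgue_measure R).
Local Notation line := (measurableTypeR R).
Local Notation plane := (product_sigma_finite leb leb).
Local Notation space := (product_sigma_finite plane leb).
Local Notation point := (line * line * line)%type.

Definition add3 (x y : point) : point :=
  (x.1.1 + y.1.1 : R, x.1.2 + y.1.2 : R, x.2 + y.2 : R)%R.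

Lemma preserves_integral_space (t : point) :
  preserves_integral space (add3 ^~ t).
Proof.
apply: (@preserves_integral_product _ _ (line * line)%type line R plane leb
  (fun x => (x.1 + t.1.1 : R, x.2 + t.1.2 : R)%R) (fun x => (x + t.2 : R)%R)).
- apply: (@preserves_integral_product _ _ line line R leb leb
    (fun x => (x + t.1.1 : R)%R) (fun x => (x + t.1.2 : R)%R));
  exact: preserves_integral_lebesgue.
- exact: preserves_integral_lebesgue.
Qed.

Definition opp3 (x : point) : point := (- x.1.1 : R, - x.1.2 : R, - x.2 : R)%R.

Lemma measurable_coords d (T : measurableType d) (u : T -> point) :
  measurable_fun setT (fun w => (u w).1.1 : R) ->
  measurable_fun setT (fun w => (u w).1.2 : R) ->
  measurable_fun setT (fun w => (u w).2 : R) -> measurable_fun setT u.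
Proof.
move=> m1 m2 m3; apply/measurable_fun_pairP; split; last exact: m3.
by apply/measurable_fun_pairP; split; [exact: m1|exact: m2].
Qed.

Lemma coords_measurable d (T : measurableType d) (u : T -> point) :
  measurable_fun setT u ->
  [/\ measurable_fun setT (fun w => (u w).1.1 : R),
      measurable_fun setT (fun w => (u w).1.2 : R) &
      measurable_fun setT (fun w => (u w).2 : R)].
Proof.
by move=> /measurable_fun_pairP[/measurable_fun_pairP[m1 m2] m3].
Qed.

Lemma measurable_add3 d (T : measurableType d) (u v : T -> point) :
  measurable_fun setT u -> measurable_fun setT v ->
  measurable_fun setT (fun w => add3 (u w) (v w)).
Proof.
move=> /coords_measurable[u1 u2 u3] /coords_measurable[v1 v2 v3].
by apply: measurable_coords; exact: measurable_funD.
Qed.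

Lemma measurable_opp3 d (T : measurableType d) (u : T -> point) :
  measurable_fun setT u -> measurable_fun setT (fun w => opp3 (u w)).
Proof.
move=> /coords_measurable[u1 u2 u3].
by apply: measurable_coords; exact: measurable_funN.
Qed.

Lemma add3K x y : add3 (add3 x y) (opp3 y) = x.
Proof. by case: x y => [[? ?] ?] [[? ?] ?]; rewrite /add3 /= !addrK. Qed.

Lemma add3C x y : add3 x y = add3 y x.
Proof. by rewrite /add3 addrC (addrC x.1.2) (addrC x.2). Qed.

Lemma opp3K x : opp3 (opp3 x) = x.
Proof. by case: x => [[? ?] ?]; rewrite /opp3 /= !opprK. Qed.

Lemma opp3D x y : opp3 (add3 x y) = add3 (opp3 x) (opp3 y).
Proof. by rewrite /opp3 /add3 /= !opprD. Qed.

Definition unit_itv : set line := (`[0%R, 1%R : R]%classic : set R).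

Definition cube : set point := (unit_itv `*` unit_itv) `*` unit_itv.

Lemma measurable_cube : measurable cube.
Proof. by repeat apply: measurableX; exact: measurable_itv. Qed.

Lemma integral_cube : \int[space]_z (\1_cube z)%:E = 1.
Proof.
have leb1 : leb unit_itv = 1.
  by rewrite /unit_itv lebesgue_measure_itv /= lte_fin ltr01 oppr0 adde0.
rewrite integral_indic //; last exact: measurable_cube.
rewrite setIT [LHS]product_measure1E //; last first.
- exact: measurable_itv.
- by apply: measurableX; exact: measurable_itv.
rewrite [X in X * _]product_measure1E; [|exact: measurable_itv|exact: measurable_itv].
by rewrite [X in X * _ * _]leb1 [X in _ * X * _]leb1 [X in _ * X]leb1 !mule1.
Qed.

(** The computation behind the uniqueness of Haar measure. In the double
    integral of f(x) g(psi z), translate x by psi z, exchange the integrals,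
    translate z so that psi z turns into psi z - x, exchange again and
    translate x back. Here [chi] is the inverse of the linear part of [psi]. *)
Lemma integral_swap_affine (psi chi : point -> point) (f g : point -> \bar R) :
  measurable_fun setT psi -> measurable_fun setT chi ->
  (forall z x, psi (add3 z (chi x)) = add3 (psi z) x) ->
  measurable_fun setT f -> (forall x, 0 <= f x) ->
  measurable_fun setT g -> (forall x, 0 <= g x) ->
  (\int[space]_x f x) * (\int[space]_z g (psi z)) =
  (\int[space]_z f (psi z)) * (\int[space]_x g (opp3 x)).
Proof.
move=> mpsi mchi psiD mf f0 mg g0.
have mfpsi : measurable_fun setT (f \o psi) by exact: measurableT_comp.
have mgpsi : measurable_fun setT (g \o psi) by exact: measurableT_comp.
have mfst : measurable_fun [set: point * point] fst by exact: measurable_fst.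
have msnd : measurable_fun [set: point * point] snd by exact: measurable_snd.
have mpsi1 : measurable_fun [set: point * point] (fun p => psi p.1).
  exact: (measurableT_comp mpsi mfst).
rewrite muleC -ge0_integralZr //; last exact: integral_ge0.
transitivity (\int[space]_z \int[space]_x (g (psi z) * f (add3 x (psi z)))).
  apply: eq_integral => z _; rewrite ge0_integralZl //; last first.
    exact: (measurableT_comp mf (preserves_integral_space (psi z)).1).
  by rewrite (preserves_integral_space (psi z)).2.
rewrite (fubini_tonelli (fun p => g (psi p.1) * f (add3 p.2 (psi p.1)))); first last.
- by move=> p; rewrite mule_ge0.
- apply: emeasurable_funM; first exact: (measurableT_comp mg mpsi1).
  apply: (measurableT_comp mf); apply: measurable_add3; [exact: msnd|exact: mpsi1].
transitivity (\int[space]_x \int[space]_z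
    (g (add3 (psi z) (opp3 x)) * f (psi z))).
  apply: eq_integral => x _ /=.
  rewrite -(preserves_integral_space (chi (opp3 x))).2; first last.
  - by move=> p; rewrite mule_ge0.
  - apply: emeasurable_funM; first exact: mgpsi.
    apply: (measurableT_comp mf); apply: measurable_add3; last exact: mpsi.
    exact: measurable_cst.
  apply: eq_integral => z _; rewrite psiD; congr (_ * f _).
  by rewrite add3C -[X in add3 _ X]opp3K add3K.
rewrite -(fubini_tonelli (fun p => g (add3 (psi p.1) (opp3 p.2)) * f (psi p.1)));
  first last.
- by move=> p; rewrite mule_ge0.
- apply: emeasurable_funM; last exact: (measurableT_comp mf mpsi1).
  apply: (measurableT_comp mg); apply: measurable_add3; first exact: mpsi1.
  exact: measurable_opp3.
rewrite -ge0_integralZr //; last exact: integral_ge0.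
apply: eq_integral => z _ /=; rewrite ge0_integralZr //; last first.
  apply: (measurableT_comp mg); apply: measurable_add3; first exact: measurable_cst.
  exact: measurable_opp3.
rewrite muleC; congr (_ * _).
have mgo : measurable_fun [set: point] (fun x => g (opp3 x)).
  by apply: (measurableT_comp mg); apply: measurable_opp3; exact: measurable_id.
have /(_ (fun x => g (opp3 x)) mgo) := (preserves_integral_space (opp3 (psi z))).2.
move=> /(_ (fun x => g0 _)) <-.
by apply: eq_integral => x _; rewrite opp3D opp3K add3C.
Qed.

(** Taking for g the reflected unit cube in [integral_swap_affine] gives the
    factor C, possibly infinite. It is positive and finite because C times
    some integral equals the volume 1 of the unit cube. *)
Lemma integral_affine (psi chi : point -> point) :
  measurable_fun setT psi -> measurable_fun setT chi -> injective psi ->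
  (forall z x, psi (add3 z (chi x)) = add3 (psi z) x) ->
  exists2 C : R, (0 < C)%R &
    forall f : point -> \bar R, measurable_fun setT f -> (forall x, 0 <= f x) ->
      \int[space]_z f (psi z) = C%:E * \int[space]_x f x.
Proof.
move=> mpsi mchi injpsi psiD.
have mindic : measurable_fun setT (EFin \o \1_cube : point -> \bar R).
  by apply/measurable_EFinP; apply: measurable_indic; exact: measurable_cube.
pose g x := EFin (\1_cube (opp3 x) : R).
have mg : measurable_fun setT g.
  by apply: (measurableT_comp mindic); apply: measurable_opp3; exact: measurable_id.
pose C := \int[space]_z g (psi z).
have key f : measurable_fun setT f -> (forall x, 0 <= f x) ->
    \int[space]_z f (psi z) = C * \int[space]_x f x.
  move=> mf f0; rewrite muleC (integral_swap_affine psi chi f g) //; last first.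
    by move=> x; rewrite lee_fin.
  under [X in _ = _ * X]eq_integral do rewrite /g opp3K.
  by rewrite integral_cube mule1.
(* A left inverse of [psi]: the indicator of the image of the cube under
   [psi] is the indicator of the cube composed with [rho]. *)
pose rho y := add3 (0, 0, 0)%R (chi (add3 y (opp3 (psi (0, 0, 0)%R)))).
have rhoK z : rho (psi z) = z.
  apply: injpsi; rewrite /rho psiD add3C.
  by have := add3K (psi z) (opp3 (psi (0, 0, 0)%R)); rewrite opp3K.
pose h z := EFin (\1_cube (rho z) : R).
have mh : measurable_fun setT h.
  apply: (measurableT_comp mindic); apply: measurable_add3; first exact: measurable_cst.
  apply: (measurableT_comp mchi); apply: measurable_add3; first exact: measurable_id.
  exact: measurable_cst.
have h0 x : 0 <= h x by rewrite lee_fin.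
have := key _ mh h0.
have -> : \int[space]_z h (psi z) = 1.
  by rewrite -integral_cube; apply: eq_integral => z _; rewrite /h rhoK.
set I := \int[space]_x h x.
have I0 : 0 <= I by apply: integral_ge0 => x _; rewrite lee_fin.
have : 0 <= C by apply: integral_ge0 => x _; rewrite lee_fin.
case: C key => [r||] key r0 E //.
- exists r; last exact: key.
  rewrite lt_neqAle -lee_fin r0 andbT; apply/eqP => r0'.
  by move: E; rewrite -r0' mul0e => /eqP; rewrite onee_eq0.
- have [I00|I1] := eqVneq I 0.
    by move: E; rewrite I00 mule0 => /eqP; rewrite onee_eq0.
  by move: E; rewrite gt0_mulye // lt_neqAle eq_sym I1.
Qed.

End AffineChange.

(** * Spans of functions *)

Section Spans.
Variable R : realType.
Local Notation V := ('rV[R]_3).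
Implicit Types (s t : seq (V -> R)) (f g : V -> R).

Lemma fct_scalerAl (c : R) f g : (c *: f) * g = c *: (f * g).
Proof. by apply/funext => x; exact/esym/mulrA. Qed.

Lemma fct_scalerAr (c : R) f g : f * (c *: g) = c *: (f * g).
Proof. by rewrite mulrC fct_scalerAl mulrC. Qed.

Lemma lin_span0 s : lin_span s 0.
Proof. by exists (fun=> 0) => //; rewrite big1 // => i _; rewrite scale0r. Qed.

Lemma lin_span_nth s i : (i < size s)%N -> lin_span s s`_i.
Proof.
move=> si; exists (fun j => (j == Ordinal si)%:R) => //.
rewrite (bigD1 (Ordinal si)) //= eqxx scale1r big1 ?addr0 // => j /negbTE ->.
by rewrite scale0r.
Qed.

Lemma lin_span_lin s (c : R) f g :
  lin_span s f -> lin_span s g -> lin_span s (c *: f + g).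
Proof.
move=> [u _ <-] [v _ <-]; exists (fun i => c * u i + v i) => //.
rewrite scaler_sumr -big_split /=; apply: eq_bigr => i _.
by rewrite scalerDl scalerA.
Qed.

Lemma lin_spanZ s (c : R) f : lin_span s f -> lin_span s (c *: f).
Proof.
by move=> sf; rewrite -[_ *: _]addr0; apply: lin_span_lin => //; exact: lin_span0.
Qed.

Lemma lin_spanD s f g : lin_span s f -> lin_span s g -> lin_span s (f + g).
Proof. by move=> sf sg; rewrite -[f]scale1r; exact: lin_span_lin. Qed.

Lemma lin_span_sum s I (r : seq I) (P : pred I) (F : I -> V -> R) :
  (forall i, P i -> lin_span s (F i)) -> lin_span s (\sum_(i <- r | P i) F i).
Proof.
move=> sF; elim/big_ind: _ => //; [exact: lin_span0|exact: lin_spanD].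
Qed.

(** Membership in a span is checked on generators, for instance after
    multiplication by a function or restriction to a set. *)
Lemma lin_span_linear_image s t (L : (V -> R) -> V -> R) :
  (forall (c : R) f g, L (c *: f + g) = c *: L f + L g) ->
  (forall i, (i < size s)%N -> lin_span t (L s`_i)) ->
  forall f, lin_span s f -> lin_span t (L f).
Proof.
move=> Llin Ls _ [c _ <-].
have L0 : L 0 = 0.
  have := Llin 1 0 0; rewrite !scale1r addr0 => E.
  by apply: (addrI (L 0)); rewrite addr0 -E.
have : forall i : 'I_(size s), lin_span t (L s`_i) by move=> i; apply: Ls.
elim/big_rec: _ => [_|i f _ IH Lt]; first by rewrite L0; exact: lin_span0.
by rewrite Llin; apply: lin_span_lin; [exact: Lt|exact: IH].
Qed.

Lemma lin_span_sub s t :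
  (forall i, (i < size s)%N -> lin_span t s`_i) -> lin_span s `<=` lin_span t.
Proof. by move=> st f; apply: (lin_span_linear_image s t id). Qed.

Lemma lin_span_map_mem (T : eqType) (r : seq T) (F : T -> V -> R) x :
  x \in r -> lin_span [seq F y | y <- r] (F x).
Proof.
move=> xr; rewrite -[x in F x](nth_index x xr) -(nth_map x 0) ?index_mem //.
by apply: lin_span_nth; rewrite size_map index_mem.
Qed.

Lemma lin_span_map_sub (T : eqType) (r : seq T) (F : T -> V -> R) t :
  {in r, forall x, lin_span t (F x)} -> lin_span [seq F y | y <- r] `<=` lin_span t.
Proof.
move=> rt; apply: lin_span_sub => i; rewrite size_map => ir.
case: r ir rt => [//|x0 r] ir rt.
by rewrite (nth_map x0) //; apply: rt; exact: mem_nth.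
Qed.

Lemma lin_span_mapP (T : Type) (x0 : T) (r : seq T) (F : T -> V -> R) f :
  lin_span [seq F e | e <- r] f <->
  exists x : 'I_(size r) -> R, f = \sum_j x j *: F (nth x0 r j).
Proof.
have E : size r = size [seq F e | e <- r] by rewrite size_map.
have reindexE c : \sum_(i < size [seq F e | e <- r]) c i *: [seq F e | e <- r]`_i =
    \sum_(j < size r) c (cast_ord E j) *: F (nth x0 r j).
  rewrite (reindex (cast_ord E)) /=; last first.
    by exists (cast_ord (esym E)) => i _; rewrite ?cast_ordK ?cast_ordKV.
  by apply: eq_bigr => j _; rewrite (nth_map x0).
split=> [[c _ <-]|[x ->]]; first by exists (fun j => c (cast_ord E j)); exact: reindexE.
exists (fun i => x (cast_ord (esym E) i)) => //.
by rewrite reindexE; apply: eq_bigr => j _; rewrite cast_ordK.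
Qed.

Lemma lin_span_cat s t :
  lin_span (s ++ t) = [set f + g | f in lin_span s & g in lin_span t].
Proof.
apply/seteqP; split=> [f [c _ <-]|_ [f sf] [g tg] <-].
  exists (\sum_(i < size s) c (cast_ord (esym (size_cat s t)) (lshift _ i)) *: s`_i).
    by exists (fun i => c (cast_ord (esym (size_cat s t)) (lshift _ i))).
  exists (\sum_(i < size t) c (cast_ord (esym (size_cat s t)) (rshift _ i)) *: t`_i).
    by exists (fun i => c (cast_ord (esym (size_cat s t)) (rshift _ i))).
  rewrite [RHS](reindex (cast_ord (esym (size_cat s t)))) /=; last first.
    by exists (cast_ord (size_cat s t)) => i _; rewrite ?cast_ordK ?cast_ordKV.
  rewrite big_split_ord /=; congr (_ + _); apply: eq_bigr => i _.
    by rewrite nth_cat ltn_ord.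
  by rewrite nth_cat ltnNge leq_addr /= addKn.
apply: lin_spanD.
  apply: lin_span_sub sf => i si.
  rewrite (_ : s`_i = (s ++ t)`_i); last by rewrite nth_cat si.
  by apply: lin_span_nth; rewrite size_cat ltn_addr.
apply: lin_span_sub tg => i ti.
rewrite (_ : t`_i = (s ++ t)`_(size s + i)); last first.
  by rewrite nth_cat ltnNge leq_addr /= addKn.
by apply: lin_span_nth; rewrite size_cat ltn_add2l.
Qed.

Lemma restrict_lin (S : set V) (c : R) f g :
  (c *: f + g) \_ S = c *: (f \_ S) + g \_ S.
Proof.
apply/funext => x; rewrite patchE.
change ((c *: (f \_ S) + g \_ S) x) with (c * (f \_ S) x + (g \_ S) x).
rewrite !patchE; case: ifP => // _.
by rewrite (_ : point = 0 :> R) // mulr0 addr0.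
Qed.

Lemma lin_span_restrict (S : set V) s :
  [set f \_ S | f in lin_span s] = lin_span [seq f \_ S | f <- s].
Proof.
apply/seteqP; split=> [_ [f sf <-]|_ /(lin_span_mapP _ 0)[c ->]].
  apply: (lin_span_linear_image s _ (fun f => f \_ S)) sf => [|i si].
    exact: restrict_lin.
  by rewrite -(nth_map 0 0) //; apply: lin_span_nth; rewrite size_map.
exists (\sum_(i < size s) c i *: s`_i); first by exists c.
elim/big_rec2: _ => [|i h k _ <-].
  by apply/funext => x; rewrite patchE; case: ifP.
by rewrite restrict_lin.
Qed.

(** A functional on [W] with prescribed values [c] on the basis [s] is the same
    as one with suitable values [y] on the generators [t], and [y] depends on
    [c] only. The values on [t] follow from those on [s] by expansion;
    conversely, expanding [s] in [t] and then in [s] again is the identity on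
    coefficients because [s] is free. *)
Lemma is_basis_transfer (W : set (V -> R)) s t (c : 'I_(size s) -> R) :
  is_basis W s -> lin_span t = W ->
  exists y : nat -> R, forall phi : (V -> R) -> R,
    (forall (b : R) f g, W f -> W g -> phi (b *: f + g) = b * phi f + phi g) ->
    (forall i : 'I_(size s), phi s`_i = c i) <->
    (forall j, (j < size t)%N -> phi t`_j = y j).
Proof.
move=> [sfree sW] tW.
have /choice[d dE] (j : nat) : exists d : 'I_(size s) -> R,
    (j < size t)%N -> t`_j = \sum_i d i *: s`_i.
  have [jt|_] := ltnP j (size t); last by exists (fun=> 0).
  have : lin_span s t`_j by rewrite sW -tW; exact: lin_span_nth.
  by move=> [d _ <-]; exists d.
exists (fun j => \sum_i d j i * c i) => phi philin.
have W0 : W 0 by rewrite -sW; exact: lin_span0.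
have phi0 : phi 0 = 0.
  have := philin 1 0 0 W0 W0; rewrite scale1r mul1r addr0 => E.
  by apply: (addrI (phi 0)); rewrite addr0 -E.
have phi_sum n (b : 'I_n -> R) (f : 'I_n -> V -> R) : (forall i, W (f i)) ->
    phi (\sum_i b i *: f i) = \sum_i b i * phi (f i).
  move=> Wf; suff [] : W (\sum_i b i *: f i) /\
    phi (\sum_i b i *: f i) = \sum_i b i * phi (f i) by [].
  elim/big_rec2: _ => [//|i r g _ [Wg <-]]; split; last exact: philin.
  by rewrite -sW in Wf Wg *; exact: lin_span_lin.
have Ws i : (i < size s)%N -> W s`_i by move=> si; rewrite -sW; exact: lin_span_nth.
have Wt j : (j < size t)%N -> W t`_j by move=> jt; rewrite -tW; exact: lin_span_nth.
split=> [phis j jt|phit i].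
  rewrite dE // phi_sum => [|i]; last exact: Ws.
  by apply: eq_bigr => i _; rewrite phis.
have : lin_span t s`_i by rewrite tW; exact: Ws.
move=> [e _ eE].
rewrite -eE phi_sum => [|j]; last exact: Wt.
under eq_bigr do rewrite phit // mulr_sumr.
rewrite exchange_big /=.
have coord i' : \sum_(j < size t) e j * d j i' = (i' == i)%:R.
  apply/eqP; rewrite -subr_eq0; apply/eqP; move: i'; apply: sfree.
  under eq_bigr do rewrite scalerBl scaler_suml.
  rewrite sumrB exchange_big /= [X in _ - X](bigD1 i) //= eqxx scale1r.
  rewrite [X in _ - (_ + X)]big1 => [|j /negbTE ->]; last by rewrite scale0r.
  rewrite addr0 -[X in _ - X]eE -sumrB big1 // => j _.
  rewrite dE // scaler_sumr -sumrB big1 // => l _.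
  by rewrite scalerA subrr.
transitivity (\sum_i' (i' == i)%:R * c i').
  apply: eq_bigr => i' _; rewrite -coord mulr_suml.
  by apply: eq_bigr => j _; rewrite mulrA.
rewrite (bigD1 i) //= eqxx mul1r big1 ?addr0 // => i' /negbTE ->.
by rewrite mul0r.
Qed.

End Spans.

(** * Barycentric coordinates and polynomial spaces *)

Section Barycentric.
Variable R : realType.
Local Notation V := ('rV[R]_3).
Variables (a : 'I_4 -> V) (a_free : nondegenerate_simplex a).
Variables (lam : 'I_4 -> V -> R) (lamP : barycentric a lam).

Lemma barycentric_sum x : \sum_i lam i x = 1.
Proof. by case: (lamP x). Qed.

Lemma barycentric_comb x : \sum_i lam i x *: a i = x.
Proof. by case: (lamP x). Qed.

(** Passing from weights on the vertices to coefficients of the edge vectors,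
    where nondegeneracy is a statement on a matrix. *)
Lemma comb_edges (t : 'I_4 -> R) :
  \sum_i t i *: a i = (\sum_i t i) *: a ord0 +
    (\row_j t (lift ord0 j)) *m edges a.
Proof.
rewrite mulmx_sum_row big_ord_recl (big_ord_recl _ (fun i => t i)) scalerDl -addrA.
congr (_ + _); rewrite scaler_suml -big_split /=; apply: eq_bigr => j _.
by rewrite mxE rowK scalerBr addrC subrK.
Qed.

Lemma barycentric_unique (t : 'I_4 -> R) x :
  \sum_i t i = 1 -> \sum_i t i *: a i = x -> forall i, lam i x = t i.
Proof.
move=> t1 tx.
have lift_eq j : lam (lift ord0 j) x = t (lift ord0 j).
  suff /rowP/(_ j) : \row_j lam (lift ord0 j) x = \row_j t (lift ord0 j) by rewrite !mxE.
  apply: (row_free_inj a_free); apply: (@addrI _ (1 *: a ord0)).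
  by rewrite -{1}(barycentric_sum x) -t1 -!comb_edges tx barycentric_comb.
move=> i; case: (unliftP ord0 i) => [j -> //|->].
have : lam ord0 x + \sum_(j < 3) lam (lift ord0 j) x =
    t ord0 + \sum_(j < 3) t (lift ord0 j).
  by rewrite -(big_ord_recl _ (lam ^~ x)) -(big_ord_recl _ t) t1 barycentric_sum.
by rewrite (eq_bigr _ (fun j _ => lift_eq j)) => /addIr.
Qed.

Lemma barycentric_affine i :
  exists (c : R) (d : 'I_3 -> R), forall x, lam i x = c + \sum_j d j * x 0 j.
Proof.
have Eunit : edges a \in unitmx by rewrite -row_free_unit.
have lift_affine x : \row_j lam (lift ord0 j) x = (x - a ord0) *m invmx (edges a).
  have := comb_edges (lam ^~ x); rewrite barycentric_sum barycentric_comb scale1r => xE.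
  by rewrite {2}xE addrAC subrr add0r mulmxK.
suff affine_lift j : exists (c : R) (d : 'I_3 -> R),
    forall x, lam (lift ord0 j) x = c + \sum_j d j * x 0 j.
  case: (unliftP ord0 i) => [j -> //|->].
  have /choice[c /choice[d cd]] := affine_lift.
  exists (1 - \sum_j c j), (fun l => - \sum_j d j l) => x.
  have := barycentric_sum x; rewrite big_ord_recl; under eq_bigr do rewrite cd.
  rewrite big_split exchange_big /= => /eqP; rewrite eq_sym -subr_eq => /eqP <-.
  rewrite opprD addrA; congr (_ + _); rewrite -sumrN; apply: eq_bigr => l _.
  by rewrite -mulr_suml mulNr.
exists (- (a ord0 *m invmx (edges a)) 0 j), (fun l => invmx (edges a) l j) => x.
have /rowP/(_ j) := lift_affine x; rewrite mxE => ->.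
rewrite mulmxBl !mxE addrC; congr (_ + _).
by apply: eq_bigr => l _; rewrite mulrC.
Qed.

Lemma conv_hullE x : conv_hull a x <-> forall i, 0 <= lam i x.
Proof.
split=> [[t [t0 t1] tx] i|lam0]; first by rewrite (barycentric_unique _ _ t1 tx).
by exists (lam ^~ x); [split=> //; exact: barycentric_sum|exact: barycentric_comb].
Qed.

(** Points of the plane of the face [i], given by affine combinations of its
    vertices. *)
Lemma barycentric_face (i : 'I_4) (t : 'I_3 -> R) x :
  \sum_j t j = 1 -> \sum_j t j *: a (lift i j) = x ->
  lam i x = 0 /\ forall j, lam (lift i j) x = t j.
Proof.
move=> t1 tx; pose u (j : 'I_4) := if unlift i j is Some l then t l else 0.
have ui : u i = 0 by rewrite /u unlift_none.
have ul j : u (lift i j) = t j by rewrite /u liftK.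
have lamE j : lam j x = u j.
  apply: barycentric_unique; rewrite (@bigD1_ord _ _ _ _ i) //=.
    by rewrite ui add0r -t1; apply: eq_bigr => l _; rewrite ul.
  by rewrite ui scale0r add0r -tx; apply: eq_bigr => l _; rewrite ul.
by split=> [|j]; rewrite lamE ?ui ?ul.
Qed.

Lemma face_hullE i x : conv_hull (face_vertices a i) x <->
  lam i x = 0 /\ forall j, 0 <= lam (lift i j) x.
Proof.
split=> [[t [t0 t1] tx]|[lami lam0]].
  by have [lami lamE] := barycentric_face _ _ _ t1 tx; split=> // j; rewrite lamE.
exists (fun j => lam (lift i j) x); first split=> //.
  by have := barycentric_sum x; rewrite (@bigD1_ord _ _ _ _ i) //= lami add0r.
have := barycentric_comb x; rewrite (@bigD1_ord _ _ _ _ i) //= lami.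
by rewrite scale0r add0r.
Qed.

Lemma face_hull_sub i : conv_hull (face_vertices a i) `<=` conv_hull a.
Proof.
move=> x /face_hullE[lami lam0]; apply/conv_hullE => j.
by case: (unliftP i j) => [l ->|->]; [exact: lam0|rewrite lami].
Qed.

Definition bary_mon (e : seq nat) : V -> R := \prod_(i < 4) lam i ^+ nth 0%N e i.

Lemma bary_monE e x : bary_mon e x = \prod_(i < 4) lam i x ^+ nth 0%N e i.
Proof. by rewrite /bary_mon fct_prodE; apply: eq_bigr => i _; rewrite exprfctE. Qed.

Definition homogeneous m : set (V -> R) :=
  lin_span [seq bary_mon e | e <- exponents 4 m].

Lemma bary_mon_incr (i : 'I_4) e : lam i * bary_mon e = bary_mon (incr_nth e i).
Proof.
apply/funext => x; change (lam i x * bary_mon e x = bary_mon (incr_nth e i) x).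
rewrite !bary_monE (bigD1 i) //= [RHS](bigD1 i) //= nth_incr_nth eqxx exprS mulrA.
congr (_ * _); apply: eq_bigr => j ji.
by rewrite nth_incr_nth (_ : (val i == val j) = false) //; apply/negbTE; rewrite eq_sym.
Qed.

Lemma homogeneous_mul_linear m (c : 'I_4 -> R) f :
  homogeneous m f -> homogeneous m.+1 ((\sum_i c i *: lam i) * f).
Proof.
apply: (lin_span_linear_image _ _ _ (fun f => (\sum_i c i *: lam i) * f)) => [b g h|l].
  by rewrite mulrDr fct_scalerAr.
rewrite size_map => lm; rewrite (nth_map [::]) // mulr_suml.
apply: lin_span_sum => i _; rewrite fct_scalerAl; apply: lin_spanZ.
rewrite bary_mon_incr; apply: lin_span_map_mem.
have := mem_nth [::] lm; rewrite !mem_exponents size_incr_nth sumn_incr_nth.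
by move=> /andP[/eqP -> /eqP ->]; rewrite ltn_ord !eqxx.
Qed.

Lemma homogeneous_one : homogeneous 0 1.
Proof.
rewrite (_ : 1 = bary_mon [:: 0; 0; 0; 0]%N); first exact: lin_span_map_mem.
by apply/funext => x; rewrite bary_monE !big_ord_recl big_ord0 /= !expr0 !mul1r.
Qed.

(** Multiplication by 1, written as the sum of the barycentric coordinates,
    raises the degree. *)
Lemma homogeneous_leq m n f : (m <= n)%N -> homogeneous m f -> homogeneous n f.
Proof.
move=> /subnK <-; elim: (n - m)%N f => // l IH f /IH Hf.
have {Hf} := @homogeneous_mul_linear _ (fun=> 1) f Hf.
rewrite (_ : \sum_i _ = 1) ?mul1r //; apply/funext => x.
rewrite fct_sumE; apply: etrans (barycentric_sum x).
by apply: eq_bigr => i _; exact: mul1r.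
Qed.

(** A Cartesian coordinate is a linear form in the barycentric ones, with the
    coordinates of the vertices as coefficients. *)
Lemma homogeneous_coord m n (j : 'I_3) f :
  homogeneous m f -> homogeneous (n + m) ((fun x : V => x 0 j ^+ n) * f).
Proof.
move=> Hf; elim: n => [|n IH].
  by rewrite (_ : (fun=> _) = 1) ?mul1r //; apply/funext => x; rewrite expr0.
rewrite (_ : (fun=> _) * f =
    (\sum_i a i 0 j *: lam i) * ((fun x : V => x 0 j ^+ n) * f)).
  exact: homogeneous_mul_linear.
rewrite mulrA; congr (_ * _); apply/funext => x; rewrite exprS; congr (_ * _).
rewrite fct_sumE -{1}(barycentric_comb x) summxE; apply: eq_bigr => i _.
by rewrite mxE mulrC.
Qed.

Lemma homogeneous_meval m (p : mpoly 3 R) :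
  (msize p <= m.+1)%N -> homogeneous m (fun x : V => meval (x 0) p).
Proof.
move=> pm.
rewrite (_ : (fun=> _) = \sum_(u <- msupp p) mcoeff u p *:
    (\prod_(j < 3) (fun x : V => x 0 j ^+ u j))); last first.
  apply/funext => x; rewrite mevalE fct_sumE; apply: eq_bigr => u _.
  by rewrite scalrfctE fct_prodE.
rewrite big_seq; apply: lin_span_sum => u up; apply: lin_spanZ.
have um : (mdeg u <= m)%N.
  by rewrite -ltnS (leq_trans _ pm) // msize_mdeg_lt.
apply: homogeneous_leq um _; rewrite mdegE.
elim/big_rec2: _ => [|j n f _ IH]; first exact: homogeneous_one.
exact: homogeneous_coord.
Qed.

Lemma msize_mul_le m n (p r : mpoly 3 R) :
  (msize p <= m.+1 -> msize r <= n.+1 -> msize (p * r) <= (m + n).+1)%N.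
Proof.
have [->|p0] := eqVneq p 0; first by rewrite mul0r msize0.
have [->|r0] := eqVneq r 0; first by rewrite mulr0 msize0.
by rewrite msizeM //; move: (msize p) (msize r) => u w; lia.
Qed.

(** The converse direction: a barycentric coordinate is an affine function of
    the Cartesian ones. *)
Lemma bary_mon_meval e :
  exists p : mpoly 3 R, (msize p <= (\sum_(i < 4) nth 0%N e i).+1)%N /\
    bary_mon e = fun x : V => meval (x 0) p.
Proof.
have affine i : exists p : mpoly 3 R, (msize p <= 2)%N /\
    lam i = fun x : V => meval (x 0) p.
  have [c [d lamE]] := barycentric_affine i.
  exists (mpolyC 3 c + \sum_j d j *: mpolyX R (mnm1 j)); split.
    apply: leq_trans (msizeD_le _ _) _; rewrite geq_max msizeC.
    apply/andP; split; first by case: eqP.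
    elim/big_ind: _ => [|p r p2 r2|j _]; first by rewrite msize0.
      by apply: leq_trans (msizeD_le _ _) _; rewrite geq_max p2.
    by apply: leq_trans (msizeZ_le _ _) _; rewrite msizeX mdeg1.
  apply/funext => x; rewrite mevalD mevalC raddf_sum lamE; congr (_ + _).
  by apply: eq_bigr => j _; rewrite /= mevalZ mevalXU.
rewrite /bary_mon; elim/big_rec2: _ => [|i n f _ [p [pn ->]]].
  by exists 1; rewrite msize1; split=> //; apply/funext => x; rewrite meval1.
have [l [l2 ->]] := affine i.
exists (l ^+ nth 0%N e i * p); split; last first.
  apply/funext => x.
  transitivity (((fun y : V => meval (y 0) l) ^+ nth 0%N e i) x * meval (x 0) p) => //.
  by rewrite exprfctE mevalM rmorphXn.
apply: msize_mul_le => //.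
elim: (nth 0%N e i) => [|m IH]; first by rewrite expr0 msize1.
by rewrite exprS; exact: (msize_mul_le 1 m _ _ l2 IH).
Qed.

End Barycentric.

Lemma sumn_ord n e : size e = n -> (\sum_(i < n) nth 0 e i)%N = sumn e.
Proof. by move=> <-; rewrite sumnE (big_nth 0%N) big_mkord. Qed.

Section PolynomialSpaces.
Variable R : realType.
Local Notation V := ('rV[R]_3).
Variables (a : 'I_4 -> V) (a_free : nondegenerate_simplex a).
Variables (lam : 'I_4 -> V -> R) (lamP : barycentric a lam).
Local Notation bmon := (bary_mon R lam).

Lemma poly_spaceE m (S : set V) :
  poly_space m S = lin_span [seq bmon e \_ S | e <- exponents 4 m].
Proof.
rewrite (map_comp (fun f => f \_ S)) -lin_span_restrict.
apply/seteqP; split=> [_ [p pm <-]|_ [f [c _ <-] <-]].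
  exists (fun x : V => meval (x 0) p) => //.
  exact: (homogeneous_meval _ a _ lamP).
suff [p pm pE] : exists2 p : mpoly 3 R, (msize p <= m.+1)%N &
    \sum_(i < size [seq bmon e | e <- exponents 4 m])
      c i *: [seq bmon e | e <- exponents 4 m]`_i = (fun x : V => meval (x 0) p).
  by exists p => //; rewrite pE.
elim/big_ind: _ => [|f1 f2 [p1 p1m E1] [p2 p2m E2]|i _].
- by exists 0; [rewrite msize0|apply/funext => x; rewrite meval0].
- exists (p1 + p2); last by rewrite E1 E2; apply/funext => x; rewrite mevalD.
  by apply: leq_trans (msizeD_le _ _) _; rewrite geq_max p1m.
have := ltn_ord i; rewrite [in X in (_ < X)%N -> _]size_map => im.
rewrite (nth_map [::]) //.
have := mem_nth [::] im; rewrite mem_exponents => /andP[/eqP s4 /eqP sm].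
have [p [pm ->]] := bary_mon_meval _ _ a_free _ lamP (nth [::] (exponents 4 m) i).
exists (c i *: p); last by apply/funext => x; rewrite mevalZ.
by apply: leq_trans (msizeZ_le _ _) _; rewrite -sm -(sumn_ord _ _ s4).
Qed.

Lemma bary_mon_face0 (i : 'I_4) e : nth 0%N e i != 0%N ->
  bmon e \_ (conv_hull (face_vertices a i)) = 0.
Proof.
move=> ei; apply/funext => x; rewrite patchE; case: ifPn => // /set_mem.
move=> /(face_hullE _ _ a_free _ lamP)[lami _].
by rewrite bary_monE (bigD1 i) //= lami expr0n (negbTE ei) mul0r.
Qed.

Lemma poly_space_faceE m (i : 'I_4) :
  poly_space m (conv_hull (face_vertices a i)) =
  lin_span [seq bmon e \_ (conv_hull (face_vertices a i))
              | e <- [seq e <- exponents 4 m | nth 0 e i == 0]%N].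
Proof.
rewrite poly_spaceE; apply/seteqP; split; apply: lin_span_map_sub => e em.
  have [ei|ei] := eqVneq (nth 0%N e i) 0%N; last first.
    by rewrite bary_mon_face0 //; exact: lin_span0.
  apply: (lin_span_map_mem _ _ _ (fun e => bmon e \_ _)).
  by rewrite mem_filter ei eqxx.
apply: (lin_span_map_mem _ _ _ (fun e => bmon e \_ _)).
by move: em; rewrite mem_filter => /andP[].
Qed.

Lemma enrichmentE k : k = 2%N \/ k = 3%N ->
  enrichment lam k.+1 = [seq bmon e | e <- enrichment_exponents k].
Proof.
have bmonE e : bmon e =
    lam 0 ^+ nth 0%N e 0 * lam 1 ^+ nth 0%N e 1 *
    lam 2 ^+ nth 0%N e 2 * lam 3 ^+ nth 0%N e 3.
  rewrite /bary_mon !big_ord_recl big_ord0 mulr1 !mulrA.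
  by congr (lam _ ^+ _ * lam _ ^+ _ * lam _ ^+ _ * lam _ ^+ _); apply: val_inj.
move=> [] ->; rewrite /= !bmonE /= !expr0 !expr1 ?mulr1 ?mul1r.
  by congr [:: _; _; _]; rewrite mulrC.
by congr [:: _; _; _; _; _]; ring.
Qed.

Lemma poly_minusE k (S : set V) : k = 2%N \/ k = 3%N ->
  poly_minus k.+1 S lam = lin_span [seq bmon e \_ S | e <- trial_exponents k].
Proof.
move=> k23; rewrite /poly_minus (enrichmentE _ k23) /trial_exponents map_cat lin_span_cat.
by rewrite poly_spaceE -map_comp.
Qed.

End PolynomialSpaces.

(** * Moments over the faces and the tetrahedron *)

Section IntegralsAlong.
Variable R : realType.
Local Notation V := ('rV[R]_3).
Context d (Z : measurableType d) (mu : {measure set Z -> \bar R}).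
Variables (D : set Z) (mD : measurable D) (p : Z -> V).

(** The functionals below are integrals of [f \o p], for [p] a parametrization
    of a face or the identification of the triples with row vectors. *)
Definition integrable_along (f : V -> R) : Prop :=
  mu.-integrable D (fun z => (f (p z))%:E).

Lemma integrable_along0 : integrable_along 0.
Proof. exact: integrable0. Qed.

Lemma integrable_along_lin (c : R) f g : integrable_along f -> integrable_along g ->
  integrable_along (c *: f + g).
Proof.
move=> fi gi; apply: (eq_integrable mD (fun z => (c%:E * (f (p z))%:E + (g (p z))%:E)%E)) => //.
by apply: integrableD => //; exact: integrableZl.
Qed.

Lemma Rintegral_along_lin (c : R) f g : integrable_along f -> integrable_along g ->
  \int[mu]_(z in D) ((c *: f + g) (p z)) =
  c * \int[mu]_(z in D) f (p z) + \int[mu]_(z in D) g (p z).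
Proof.
move=> fi gi; rewrite -RintegralZl // -RintegralD //.
exact: (@integrableZl _ _ _ mu D mD c (fun z => (f (p z))%:E) fi).
Qed.

Lemma Rintegral_along0 : \int[mu]_(z in D) ((0 : V -> R) (p z)) = 0.
Proof. by rewrite /Rintegral integral0. Qed.

End IntegralsAlong.

Arguments integrable_along {R d Z}.
Arguments integrable_along0 {R d Z mu D}.
Arguments integrable_along_lin {R d Z mu D} mD {p}.
Arguments Rintegral_along_lin {R d Z mu D} mD {p}.
Arguments Rintegral_along0 {R d Z}.

Lemma bigop_face (T : Type) (idx : T) (op : Monoid.com_law idx) (i : 'I_4) (F : 'I_4 -> T) :
  \big[op/idx]_(j < 4) F j =
  op (F i) (op (F (lift i (0 : 'I_3)))
    (op (F (lift i (1 : 'I_3))) (F (lift i (2 : 'I_3))))).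
Proof.
rewrite (@bigD1_ord _ _ _ _ i) //= !big_ord_recl big_ord0 Monoid.mulm1.
by congr (op _ (op _ (op (F (lift i _)) (F (lift i _))))); apply: val_inj.
Qed.

Lemma ord3_cases (j : 'I_3) : [\/ j = 0, j = 1 | j = 2].
Proof.
case: j => [[|[|[|//]]] j_lt3].
- by constructor 1; apply: val_inj.
- by constructor 2; apply: val_inj.
- by constructor 3; apply: val_inj.
Qed.

Lemma fact_seqE e : size e = 4 -> fact_seq e = (\prod_(j < 4) (nth 0 e j)`!)%N.
Proof.
move=> s4; rewrite /fact_seq -[LHS]/(foldr _ _ _) foldrE big_map (big_nth 0%N).
by rewrite big_mkord s4.
Qed.

Lemma add_seq_nth e g j : size e = size g ->
  nth 0%N (add_seq e g) j = (nth 0 e j + nth 0 g j)%N.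
Proof.
move=> eg; have [js|js] := ltnP j (size e).
  by rewrite (nth_map (0, 0)%N) ?size_zip -?eg ?minnn // nth_zip.
rewrite !nth_default // -?eg // size_map size_zip -eg minnn //.
Qed.

Lemma sumn_add_seq e g : size e = size g -> sumn (add_seq e g) = (sumn e + sumn g)%N.
Proof.
elim: e g => [|i e IH] [|j g] //= [/IH]; rewrite /add_seq => -> ; lia.
Qed.

Section SimplexMoments.
Variable R : realType.
Local Notation leb := (@lebesgue_measure R).
Local Notation line := (measurableTypeR R).
Local Notation plane := (product_sigma_finite leb leb).

Lemma integrable_triangle_monomial l m n :
  plane.-integrable (ref_triangle R)
    (fun z : line * line => ((z.1 : R) ^+ l * ((z.2 : R) ^+ m * (1 - z.1 - z.2) ^+ n))%:E).
Proof.
apply/integrableP; split.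
  apply/measurable_EFinP/measurable_funTS.
  have m1 : measurable_fun [set: line * line] (fun z => z.1 : R) by exact: measurable_fst.
  have m2 : measurable_fun [set: line * line] (fun z => z.2 : R) by exact: measurable_snd.
  apply: measurable_funM; first exact: measurable_funX.
  apply: measurable_funM; first exact: measurable_funX.
  apply: measurable_funX; apply: measurable_funB => //.
  exact: measurable_funB.
rewrite (eq_integral (fun z : line * line =>
    ((z.1 : R) ^+ l * ((z.2 : R) ^+ m * (1 - z.1 - z.2) ^+ n))%:E)).
  by rewrite dirichlet_triangle ltry.
move=> z /set_mem[z1 z2 z12]; rewrite gee0_abs // lee_fin.
by rewrite !mulr_ge0 ?exprn_ge0 // -addrA -opprD subr_ge0.
Qed.

End SimplexMoments.

Section Moments.
Variable R : realType.
Local Notation V := ('rV[R]_3).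
Local Notation leb := (@lebesgue_measure R).
Local Notation line := (measurableTypeR R).
Local Notation plane := (product_sigma_finite leb leb).
Local Notation space := (product_sigma_finite plane leb).
Variables (a : 'I_4 -> V) (a_free : nondegenerate_simplex a).
Variables (lam : 'I_4 -> V -> R) (lamP : barycentric a lam).
Local Notation bmon := (bary_mon R lam).
Local Notation tetra := (conv_hull a).
Local Notation face i := (conv_hull (face_vertices a i)).

Definition triangle_param (b : 'I_3 -> V) (z : line * line) : V :=
  b 0 + (z.1 : R) *: (b 1 - b 0) + (z.2 : R) *: (b 2 - b 0).

Definition triangle_integrable (b : 'I_3 -> V) : (V -> R) -> Prop :=
  integrable_along plane (ref_triangle R) (triangle_param b).

Lemma triangle_integral_lin b (c : R) f g :
  triangle_integrable b f -> triangle_integrable b g ->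
  triangle_integral b (c *: f + g) = c * triangle_integral b f + triangle_integral b g.
Proof.
move=> fi gi; rewrite /triangle_integral mulrCA -mulrDr; congr (_ * _).
exact: (Rintegral_along_lin (measurable_ref_triangle R) c f g fi gi).
Qed.

Lemma triangle_integral0 b : triangle_integral b (0 : V -> R) = 0.
Proof.
have int0 := Rintegral_along0 plane (ref_triangle R) (triangle_param b).
by rewrite /triangle_integral [X in _ * X]int0 mulr0.
Qed.

Definition volume_integrable : (V -> R) -> Prop :=
  integrable_along space (@vec3 R @^-1` tetra) (@vec3 R).

Lemma sum3 (W : zmodType) (F : 'I_3 -> W) : \sum_i F i = F 0 + F 1 + F 2.
Proof.
rewrite !big_ord_recl big_ord0 addr0 addrA.
by congr (_ + F _ + F _); apply: val_inj.
Qed.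

Lemma face_param_coords (i : 'I_4) z : let x := triangle_param (face_vertices a i) z in
  [/\ lam i x = 0, lam (lift i (0 : 'I_3)) x = 1 - z.1 - z.2,
      lam (lift i (1 : 'I_3)) x = z.1 & lam (lift i (2 : 'I_3)) x = z.2].
Proof.
move=> x; pose t (j : 'I_3) : R := [:: 1 - z.1 - z.2 : R; z.1 : R; z.2 : R]`_j.
have [||l0 lE] := barycentric_face _ _ a_free _ lamP i t x.
- by rewrite sum3 /t /=; lra.
- rewrite sum3 /t /= /x /triangle_param /face_vertices.
  by apply/rowP => l; rewrite !mxE; ring.
by rewrite l0 !lE.
Qed.

(** Two coefficient vectors with the same combination of edges would be two
    systems of barycentric coordinates of one point. *)
Lemma face_nondegenerate i : row_free (edges (face_vertices a i)).
Proof.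
apply: inj_row_free => u u0.
have E1 : lift ord0 (ord0 : 'I_2) = 1 :> 'I_3 by exact: val_inj.
have E2 : lift ord0 (lift ord0 ord0 : 'I_2) = 2 :> 'I_3 by exact: val_inj.
have E3 : lift ord0 ord0 = 1 :> 'I_2 by exact: val_inj.
have xE : triangle_param (face_vertices a i) (u 0 0, u 0 1) =
    triangle_param (face_vertices a i) (0, 0).
  rewrite /triangle_param /= !scale0r !addr0 -[RHS]addr0 -u0 mulmx_sum_row.
  by rewrite !big_ord_recl big_ord0 addr0 !rowK E1 E2 E3 -addrA.
have [_ _ u1 u2] := face_param_coords i (u 0 0, u 0 1).
have [_ _ v1 v2] := face_param_coords i (0, 0).
apply/rowP => j; rewrite mxE.
move: u1 u2 v1 v2; rewrite /= xE => -> -> u1 u2.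
case: (unliftP ord0 j) => [l ->|->]; last exact: u1.
by rewrite (ord1 l) (_ : lift _ _ = 1) //; exact: val_inj.
Qed.

(** Lagrange's identity: the Gram determinant is the squared norm of the cross
    product. *)
Lemma gram_det (E : 'M[R]_(2, 3)) :
  \det (E *m E^T) = (E 0 0 * E 1 1 - E 0 1 * E 1 0) ^+ 2 +
    (E 0 0 * E 1 2 - E 0 2 * E 1 0) ^+ 2 + (E 0 1 * E 1 2 - E 0 2 * E 1 1) ^+ 2.
Proof.
have mxEE i j : (E *m E^T) i j = E i 0 * E j 0 + E i 1 * E j 1 + E i 2 * E j 2.
  by rewrite mxE sum3 !mxE.
have det2 (M : 'M[R]_2) : \det M = M 0 0 * M 1 1 - M 0 1 * M 1 0.
  rewrite (expand_det_row _ 0) !big_ord_recl big_ord0 /cofactor !det_mx11 !mxE /=.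
  rewrite expr0 expr1 mul1r addr0 mulN1r mulrN.
  by congr (M _ _ * M _ _ - M _ _ * M _ _); apply: val_inj.
by rewrite det2 !mxEE; ring.
Qed.

Lemma gram_det_gt0 (E : 'M[R]_(2, 3)) : row_free E -> 0 < \det (E *m E^T).
Proof.
move=> E_free; rewrite lt_neqAle gram_det !addr_ge0 ?sqr_ge0 // andbT -gram_det.
rewrite eq_sym; apply/det0P => -[u u0 uEE].
have : (u *m E) *m (u *m E)^T = 0.
  by rewrite trmx_mul mulmxA -[_ *m E *m _]mulmxA uEE mul0mx.
move=> /matrixP/(_ 0 0); rewrite !mxE => /eqP.
rewrite psumr_eq0 => [/allP uE0|l _]; last by rewrite [_^T _ _]mxE -expr2 sqr_ge0.
suff uE : u *m E = 0.
  move: u0; have -> : u = 0 by apply: (row_free_inj E_free); rewrite mul0mx.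
  by rewrite eqxx.
apply/rowP => l; have := uE0 l (mem_index_enum _).
by rewrite /= [_^T _ _]mxE mulf_eq0 orbb => /eqP ->; rewrite mxE.
Qed.

Definition area_element (i : 'I_4) : R :=
  Num.sqrt (\det (edges (face_vertices a i) *m (edges (face_vertices a i))^T)).

Lemma area_element_neq0 i : area_element i != 0.
Proof. by rewrite gt_eqF // sqrtr_gt0; apply: gram_det_gt0; exact: face_nondegenerate. Qed.

Lemma ref_triangle_face i z : ref_triangle R z ->
  face i (triangle_param (face_vertices a i) z).
Proof.
move=> [z1 z2 z12]; have [l0 l1 l2 l3] := face_param_coords i z.
apply/(face_hullE _ _ a_free _ lamP); split=> // j.
have [->|->|->] := ord3_cases j.
- by rewrite l1 -addrA -opprD subr_ge0.
- by rewrite l2.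
- by rewrite l3.
Qed.

Lemma bary_mon_face_param i e z : bmon e (triangle_param (face_vertices a i) z) =
  (nth 0%N e i == 0%N)%:R *
  (z.1 ^+ nth 0%N e (lift i (1 : 'I_3)) * (z.2 ^+ nth 0%N e (lift i (2 : 'I_3)) *
     (1 - z.1 - z.2) ^+ nth 0%N e (lift i (0 : 'I_3)))).
Proof.
have [l0 l1 l2 l3] := face_param_coords i z.
by rewrite bary_monE (bigop_face _ _ _ i) /= l0 l1 l2 l3 expr0n; ring.
Qed.

Lemma eq_triangle_integral i f g : (forall x, face i x -> f x = g x) ->
  triangle_integral (face_vertices a i) f = triangle_integral (face_vertices a i) g.
Proof.
move=> fg; rewrite /triangle_integral; congr (_ * _).
by apply: eq_Rintegral => z /set_mem /(ref_triangle_face i); exact: fg.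
Qed.

Lemma eq_triangle_integrable i f g : (forall x, face i x -> f x = g x) ->
  triangle_integrable (face_vertices a i) f -> triangle_integrable (face_vertices a i) g.
Proof.
move=> fg; apply: eq_integrable; first exact: measurable_ref_triangle.
by move=> z /set_mem /(ref_triangle_face i) /fg ->.
Qed.

(** The powers of the coordinate that vanishes on the face contribute 1 or 0
    according to their exponent; the rest is [dirichlet_triangle]. *)
Lemma face_moment (i : 'I_4) e : size e = 4 ->
  triangle_integrable (face_vertices a i) (bmon e) /\
  triangle_integral (face_vertices a i) (bmon e) =
    area_element i * (if nth 0%N e i == 0%N
                   then (fact_seq e)%:R / (sumn e + 2)`!%:R else 0).
Proof.
move=> s4; set l := nth 0%N e (lift i (1 : 'I_3)); set m := nth 0%N e (lift i (2 : 'I_3)).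
set n := nth 0%N e (lift i (0 : 'I_3)).
have paramE z : bmon e (triangle_param (face_vertices a i) z) =
    (nth 0%N e i == 0%N)%:R * (z.1 ^+ l * (z.2 ^+ m * (1 - z.1 - z.2) ^+ n)).
  exact: bary_mon_face_param.
have mono := integrable_triangle_monomial R l m n.
split.
  apply: (eq_integrable (measurable_ref_triangle R) (fun z : line * line =>
    ((nth 0%N e i == 0%N)%:R%:E *
     ((z.1 : R) ^+ l * ((z.2 : R) ^+ m * (1 - z.1 - z.2) ^+ n))%:E)%E)).
    by move=> z _; rewrite paramE.
  by apply: integrableZl => //; exact: measurable_ref_triangle.
rewrite /triangle_integral -/(area_element i); congr (_ * _).
transitivity (\int[plane]_(z in ref_triangle R) ((nth 0%N e i == 0%N)%:R *
   ((z.1 : R) ^+ l * ((z.2 : R) ^+ m * (1 - z.1 - z.2) ^+ n)))).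
  by apply: eq_Rintegral => z _; exact: paramE.
rewrite RintegralZl //; last exact: measurable_ref_triangle.
rewrite /Rintegral dirichlet_triangle /=.
case: eqP => [ei|_]; last by rewrite mul0r.
rewrite mul1r (fact_seqE _ s4) -(sumn_ord _ _ s4) (bigop_face _ _ _ i) /=.
rewrite (bigop_face _ _ _ i) /= ei mul1n add0n addn2 -/l -/m -/n.
congr (_%:R / _%:R); first by rewrite mulnA mulnC.
by congr (_.+2`!); rewrite addnC.
Qed.

Lemma bary_mon_mul e g : size e = size g -> bmon e * bmon g = bmon (add_seq e g).
Proof.
move=> eg; rewrite /bary_mon -big_split /=; apply: eq_bigr => j _.
by rewrite add_seq_nth // exprD.
Qed.

Lemma face_test_moment (i : 'I_4) e g : size e = 4 -> size g = 4 ->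
  let f := bmon e \_ tetra * bmon g \_ (face i) in
  triangle_integrable (face_vertices a i) f /\
  triangle_integral (face_vertices a i) f =
    area_element i * (if nth 0%N (add_seq e g) i == 0%N
       then (fact_seq (add_seq e g))%:R / (sumn e + sumn g + 2)`!%:R else 0).
Proof.
move=> e4 g4 f; have eg : size e = size g by rewrite e4 g4.
have s4 : size (add_seq e g) = 4 by rewrite size_map size_zip e4 g4.
have [int_eg val_eg] := face_moment i _ s4.
have fE x : face i x -> bmon (add_seq e g) x = f x.
  move=> fx; rewrite -bary_mon_mul // /f.
  change ((bmon e) x * (bmon g) x = (bmon e \_ tetra) x * (bmon g \_ (face i)) x).
  by rewrite !patchE !mem_set //; exact: face_hull_sub fx.
split; first exact: eq_triangle_integrable fE int_eg.
by rewrite -(eq_triangle_integral _ _ _ fE) val_eg sumn_add_seq.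
Qed.

Local Notation point := (line * line * line)%type.

(** The affine bijection that carries the tetrahedron to the reference
    tetrahedron; [edge_map] is the inverse of its linear part. *)
Definition barycentric_map (z : point) : point :=
  (lam (lift ord0 (0 : 'I_3)) (vec3 z), lam (lift ord0 (1 : 'I_3)) (vec3 z),
   lam (lift ord0 (2 : 'I_3)) (vec3 z)).

Definition edge_comb (x : point) : V :=
  \sum_(j < 3) [:: x.1.1 : R; x.1.2 : R; x.2 : R]`_j *: (a (lift ord0 j) - a ord0).

Definition edge_map (x : point) : point :=
  (edge_comb x 0 0, edge_comb x 0 1, edge_comb x 0 2).

Lemma vec3E (z : point) :
  [/\ vec3 z 0 0 = z.1.1 :> R, vec3 z 0 1 = z.1.2 :> R & vec3 z 0 2 = z.2 :> R].
Proof. by rewrite /vec3 !mxE. Qed.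

Lemma row3P (u v : V) : u 0 0 = v 0 0 -> u 0 1 = v 0 1 -> u 0 2 = v 0 2 -> u = v.
Proof.
move=> h0 h1 h2; apply/rowP => j.
have [->|->|->] := ord3_cases j => //.
Qed.

Lemma measurable_affine (c d1 d2 d3 : R) :
  measurable_fun [set: point] (fun z : point => c + d1 * z.1.1 + d2 * z.1.2 + d3 * z.2 : R).
Proof.
have [m1 m2 m3] := coords_measurable R _ _ id (@measurable_id _ point setT).
repeat apply: measurable_funD; by [exact: measurable_cst|apply: measurable_funM].
Qed.

Lemma measurable_barycentric_map : measurable_fun setT barycentric_map.
Proof.
have mlam i : measurable_fun [set: point] (fun z : point => lam i (vec3 z)).
  have [c [d lamE]] := barycentric_affine _ _ a_free _ lamP i.
  apply: (eq_measurable_fun (fun z : point =>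
    c + d 0 * z.1.1 + d 1 * z.1.2 + d 2 * z.2 : R)).
    by move=> z _; rewrite lamE sum3; have [-> -> ->] := vec3E z; rewrite !addrA.
  exact: measurable_affine.
by apply: measurable_coords; exact: mlam.
Qed.

Lemma measurable_edge_map : measurable_fun setT edge_map.
Proof.
have mcoord j : measurable_fun [set: point] (fun x : point => edge_comb x 0 j).
  pose d l := (a (lift ord0 l) - a ord0) 0 j.
  apply: (eq_measurable_fun (fun z : point =>
    0 + d 0 * z.1.1 + d 1 * z.1.2 + d 2 * z.2 : R)).
    by move=> z _; rewrite add0r /d /edge_comb sum3 !mxE /=; ring.
  exact: measurable_affine.
by apply: measurable_coords; exact: mcoord.
Qed.

Lemma barycentric_map_shift z x :
  barycentric_map (add3 R z (edge_map x)) = add3 R (barycentric_map z) x.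
Proof.
have vE : vec3 (add3 R z (edge_map x)) = vec3 z + edge_comb x.
  by apply: row3P; have [E0 E1 E2] := vec3E (add3 R z (edge_map x));
     have [F0 F1 F2] := vec3E z; rewrite ?E0 ?E1 ?E2 mxE ?F0 ?F1 ?F2.
pose X (l : 'I_3) : R := [:: x.1.1 : R; x.1.2 : R; x.2 : R]`_l.
pose s (j : 'I_4) := if unlift ord0 j is Some l then X l else - \sum_l X l.
have s0 : s ord0 = - \sum_l X l by rewrite /s unlift_none.
have sl l : s (lift ord0 l) = X l by rewrite /s liftK.
have lamE j : lam j (vec3 z + edge_comb x) = lam j (vec3 z) + s j.
  apply: (barycentric_unique _ _ a_free _ lamP (fun j => lam j (vec3 z) + s j)).
    rewrite big_split /= (barycentric_sum _ _ _ lamP) big_ord_recl s0.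
    by rewrite (eq_bigr X (fun l _ => sl l)) addNr addr0.
  under eq_bigr do rewrite scalerDl.
  rewrite big_split /= (barycentric_comb _ _ _ lamP); congr (_ + _).
  rewrite big_ord_recl s0 scaleNr scaler_suml addrC -sumrB.
  by apply: eq_bigr => l _; rewrite sl scalerBr.
by rewrite /barycentric_map vE !lamE !sl.
Qed.

Lemma barycentric_map_ord0 z : lam ord0 (vec3 z) =
  1 - (barycentric_map z).1.1 - (barycentric_map z).1.2 - (barycentric_map z).2.
Proof.
have := barycentric_sum _ _ _ lamP (vec3 z); rewrite (bigop_face _ _ _ ord0) /=.
by move=> <-; rewrite /barycentric_map /=; ring.
Qed.

Lemma barycentric_map_inj : injective barycentric_map.
Proof.
move=> z w zw; have l0 : lam ord0 (vec3 z) = lam ord0 (vec3 w).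
  by rewrite !barycentric_map_ord0 zw.
move: zw => [l1 l2 l3].
have vzw : vec3 z = vec3 w.
  rewrite -(barycentric_comb _ _ _ lamP (vec3 z)) -(barycentric_comb _ _ _ lamP (vec3 w)).
  by rewrite !(bigop_face _ _ _ ord0) /= l0 l1 l2 l3.
have [z1 z2 z3] := vec3E z; have [w1 w2 w3] := vec3E w.
move: z1 z2 z3 w1 w2 w3; rewrite vzw => -> -> -> w1 w2 w3.
by case: z w w1 w2 w3 {l0 l1 l2 l3 vzw} => [[? ?] ?] [[? ?] ?] /= -> -> ->.
Qed.

Lemma tetra_preimage : @vec3 R @^-1` tetra = barycentric_map @^-1` (ref_tetrahedron R).
Proof.
apply/seteqP; split=> z.
  move=> /(conv_hullE _ _ a_free _ lamP) l0.
  have := l0 ord0; rewrite barycentric_map_ord0 => s0.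
  split; last by rewrite l0 /= -subr_ge0.
  split; [exact: l0|exact: l0|].
  have := l0 (lift ord0 2); move: s0; rewrite /barycentric_map /=; lra.
move=> [[l1 l2 _] /andP[l3 s0]]; apply/(conv_hullE _ _ a_free _ lamP) => i.
case: (unliftP ord0 i) => [j ->|->]; last by rewrite barycentric_map_ord0 subr_ge0.
have [->|->|->] := ord3_cases j => //.
Qed.

Lemma measurable_tetra_preimage :
  measurable (@vec3 R @^-1` tetra : set point).
Proof.
rewrite tetra_preimage -[X in measurable X]setTI.
by apply: measurable_barycentric_map => //; exact: measurable_ref_tetrahedron.
Qed.

Lemma volume_integral_lin (c : R) f g :
  volume_integrable f -> volume_integrable g ->
  volume_integral tetra (c *: f + g) =
  c * volume_integral tetra f + volume_integral tetra g.
Proof.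
by move=> fi gi; exact: (Rintegral_along_lin measurable_tetra_preimage c f g fi gi).
Qed.

Lemma volume_integral0 : volume_integral tetra (0 : V -> R) = 0.
Proof. exact: (Rintegral_along0 space (@vec3 R @^-1` tetra) (@vec3 R)). Qed.

(** The integral over the tetrahedron becomes an integral over the reference
    tetrahedron by [integral_affine] applied to [barycentric_map], and then
    [dirichlet_tetrahedron] gives its value. *)
Lemma volume_moment : exists2 C : R, 0 < C & forall e, size e = 4 ->
  volume_integrable (bmon e \_ tetra) /\
  volume_integral tetra (bmon e \_ tetra) = C * ((fact_seq e)%:R / (sumn e + 3)`!%:R).
Proof.
have [C C0 CE] := integral_affine R _ _ measurable_barycentric_map measurable_edge_map
  barycentric_map_inj barycentric_map_shift.
exists C => // e s4; pose D := @vec3 R @^-1` tetra.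
pose l := nth 0%N e (lift ord0 (0 : 'I_3)); pose m := nth 0%N e (lift ord0 (1 : 'I_3)).
pose n := nth 0%N e (lift ord0 (2 : 'I_3)); pose q := nth 0%N e (ord0 : 'I_4).
pose mono (w : point) : R := (w.1.1 : R) ^+ l * (w.1.2 : R) ^+ m *
  ((w.2 : R) ^+ n * (1 - w.1.1 - w.1.2 - w.2) ^+ q).
have bmonE z : bmon e (vec3 z) = mono (barycentric_map z).
  rewrite bary_monE (bigop_face _ _ _ ord0) /= barycentric_map_ord0 /mono.
  by rewrite /barycentric_map /=; ring.
have mono0 w : ref_tetrahedron R w -> 0 <= mono w.
  move=> [[w1 w2 w12] /andP[w3 w4]]; rewrite /mono !mulr_ge0 ?exprn_ge0 //.
  by rewrite subr_ge0.
have [m1 m2 m3] := coords_measurable R _ _ id (@measurable_id _ point setT).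
have mmono : measurable_fun setT mono.
  apply: measurable_funM; apply: measurable_funM; apply: measurable_funX => //.
  apply: measurable_funB => //; apply: measurable_funB => //.
  exact: measurable_funB.
have mD : measurable D := measurable_tetra_preimage.
pose F := (EFin \o mono) \_ (ref_tetrahedron R).
have DE z : (z \in D) = (barycentric_map z \in ref_tetrahedron R).
  by rewrite /D tetra_preimage; apply/idP/idP; rewrite !inE.
have intE : (\int[space]_(z in D) (bmon e (vec3 z))%:E)%E =
    (C * ((fact_seq e)%:R / (sumn e + 3)`!%:R))%:E.
  transitivity (\int[space]_z F (barycentric_map z))%E.
    rewrite integral_mkcond; apply: eq_integral => z _.
    by rewrite /F !patchE DE /= bmonE.
  rewrite CE; first last.
  - by move=> w; rewrite /F patchE; case: ifPn => // /set_mem /mono0; rewrite lee_fin.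
  - apply/(measurable_restrictT _ (measurable_ref_tetrahedron R)).
    by apply/measurable_EFinP; exact: measurable_funTS.
  rewrite -integral_mkcond dirichlet_tetrahedron -EFinM; congr (C * (_ / _))%:E.
    rewrite (fact_seqE _ s4) (bigop_face _ _ _ ord0) /= -/l -/m -/n -/q.
    by congr (_%:R); rewrite !mulnA; lia.
  rewrite -(sumn_ord _ _ s4) (bigop_face _ _ _ ord0) /= -/l -/m -/n -/q.
  by congr ((_)`!%:R); lia.
have restrE z : D z -> (bmon e \_ tetra) (vec3 z) = bmon e (vec3 z).
  by move=> Dz; rewrite patchE mem_set.
split.
  apply/integrableP; split.
    apply/measurable_EFinP.
    apply: (eq_measurable_fun (mono \o barycentric_map)).
      by move=> z /set_mem Dz; rewrite restrE // bmonE.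
    apply: measurable_funTS; apply: (measurableT_comp mmono).
    exact: measurable_barycentric_map.
  rewrite (eq_integral (fun z : point => (bmon e (vec3 z))%:E)) ?intE ?ltry //.
  move=> z zD; have Dz := set_mem zD; rewrite restrE // gee0_abs // lee_fin bmonE.
  by apply: mono0; move: Dz; rewrite /D tetra_preimage.
rewrite /volume_integral -[RHS]/(fine (_%:E)) -intE.
apply: (@eq_Rintegral _ _ _ space D) => z /set_mem Dz; exact: restrE.
Qed.

End Moments.

(** * Unisolvence *)

Section Assembly.
Variable R : realType.
Local Notation V := ('rV[R]_3).
Variables (a : 'I_4 -> V) (a_free : nondegenerate_simplex a).
Variables (lam : 'I_4 -> V -> R) (lamP : barycentric a lam).
Local Notation bmon := (bary_mon R lam).
Local Notation tetra := (conv_hull a).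
Local Notation face i := (conv_hull (face_vertices a i)).

Lemma triangle_integral_sum b n (c : 'I_n -> R) (f : 'I_n -> V -> R) :
  (forall i, triangle_integrable R b (f i)) ->
  triangle_integrable R b (\sum_i c i *: f i) /\
  triangle_integral b (\sum_i c i *: f i) = \sum_i c i * triangle_integral b (f i).
Proof.
move=> fi; elim/big_rec2: _ => [|i s g _ [gi gs]].
  by split; [exact: integrable_along0|exact: triangle_integral0].
split; first exact: (integrable_along_lin (measurable_ref_triangle R) _ _ _ (fi i) gi).
by rewrite triangle_integral_lin // gs.
Qed.

Lemma volume_integral_sum n (c : 'I_n -> R) (f : 'I_n -> V -> R) :
  (forall i, volume_integrable R a (f i)) ->
  volume_integral tetra (\sum_i c i *: f i) = \sum_i c i * volume_integral tetra (f i).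
Proof.
move=> fi; have mD := measurable_tetra_preimage _ _ a_free _ lamP.
suff [] : volume_integrable R a (\sum_i c i *: f i) /\
  volume_integral tetra (\sum_i c i *: f i) = \sum_i c i * volume_integral tetra (f i) by [].
elim/big_rec2: _ => [|i s g _ [gi gs]].
  by split; [exact: integrable_along0|exact: volume_integral0].
split; first exact: (integrable_along_lin mD _ _ _ (fi i) gi).
by rewrite (volume_integral_lin _ _ a_free _ lamP) // gs.
Qed.

Variable k : nat.
Hypothesis k_gt0 : (0 < k)%N.
Hypothesis trial_wf :
  {in trial_exponents k, forall e, size e = 4 /\ (k <= sumn e <= k.+1)%N}.

Definition trial_fun (x : 'I_(size (trial_exponents k)) -> R) : V -> R :=
  \sum_s x s *: (bmon (nth [::] (trial_exponents k) s) \_ tetra).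

Definition test_fun (i : 'I_4) (g : seq nat) : V -> R := bmon g \_ (face i).

Lemma test_exponentsP i g : g \in test_exponents k i ->
  [/\ size g = 4, sumn g = k.-1 & nth 0%N g i = 0%N].
Proof.
by rewrite mem_filter mem_exponents => /andP[/eqP gi /andP[/eqP -> /eqP ->]].
Qed.

Lemma trial_exponentsP (s : 'I_(size (trial_exponents k))) :
  size (nth [::] (trial_exponents k) s) = 4 /\
  (k <= sumn (nth [::] (trial_exponents k) s) <= k.+1)%N.
Proof. by apply: trial_wf; exact: mem_nth. Qed.

(** Integrability of the products, by which the face moments are linear in the
    test function. *)
Lemma trial_test_integrable (i : 'I_4) x f :
  lin_span [seq test_fun i g | g <- test_exponents k i] f ->
  triangle_integrable R (face_vertices a i) (trial_fun x * f).
Proof.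
move=> /(lin_span_mapP _ _ [::])[y ->]; rewrite mulr_sumr.
under eq_bigr do rewrite fct_scalerAr.
apply: (triangle_integral_sum _ _ _ _ _).1 => j.
rewrite mulr_suml; under eq_bigr do rewrite fct_scalerAl.
apply: (triangle_integral_sum _ _ _ _ _).1 => s.
have [g4 _ _] := test_exponentsP i _ (mem_nth [::] (ltn_ord j)).
by have [] := face_test_moment _ _ a_free _ lamP i _ _ (trial_exponentsP s).1 g4.
Qed.

Lemma scaled_momentE N n e : (sumn e + n <= N)%N ->
  (fact_seq e)%:R / (sumn e + n)`!%:R = (scaled_moment N n e)%:R / N`!%:R :> R.
Proof.
move=> eN; rewrite /scaled_moment -(ffact_fact (leq_subr (sumn e + n) N)) subKn //.
rewrite !natrM; have fz m : m`!%:R != 0 :> R by rewrite pnatr_eq0 -lt0n fact_gt0.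
have ffz : (N ^_ (N - (sumn e + n)))%:R != 0 :> R.
  by rewrite pnatr_eq0 -lt0n ffact_gt0 leq_subr.
move: (_`!%:R) (fz (sumn e + n)%N) (_%:R) ffz => u u0 w w0.
by field; rewrite u0 w0.
Qed.

Lemma face_dof (i : 'I_4) g x : g \in test_exponents k i ->
  triangle_integral (face_vertices a i) (trial_fun x * test_fun i g) =
  area_element R a i / (k.*2 + 2)`!%:R *
    \sum_(s < size (trial_exponents k)) ZtoR R (nth Z0 (face_row k i g) s) * x s.
Proof.
move=> gtest; have [g4 gk gi] := test_exponentsP i g gtest.
rewrite mulr_suml; under eq_bigr do rewrite fct_scalerAl.
have H s := face_test_moment _ _ a_free _ lamP i _ _ (trial_exponentsP s).1 g4.
rewrite (triangle_integral_sum _ _ _ _ (fun s => (H s).1)).2 mulr_sumr.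
apply: eq_bigr => s _; rewrite (H s).2 (nth_map [::]) // ZtoR_nat.
have [s4 /andP[_ sk]] := trial_exponentsP s.
rewrite add_seq_nth ?s4 ?g4 // gi addn0.
case: ifP => _; last by rewrite !(mulr0, mul0r).
rewrite -(sumn_add_seq _ g) ?s4 ?g4 // (scaled_momentE (k.*2 + 2)).
  by ring.
by rewrite sumn_add_seq ?s4 ?g4 // gk; lia.
Qed.

Lemma volume_dof (C : R) x :
  (forall e, size e = 4 -> volume_integrable R a (bmon e \_ tetra) /\
     volume_integral tetra (bmon e \_ tetra) = C * ((fact_seq e)%:R / (sumn e + 3)`!%:R)) ->
  volume_integral tetra (trial_fun x) =
  C / (k + 4)`!%:R *
    \sum_(s < size (trial_exponents k)) ZtoR R (nth Z0 (volume_row k) s) * x s.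
Proof.
move=> CE; rewrite volume_integral_sum => [|s]; last exact: (CE _ (trial_exponentsP s).1).1.
rewrite mulr_sumr; apply: eq_bigr => s _.
have [s4 /andP[_ sk]] := trial_exponentsP s.
rewrite (CE _ s4).2 (nth_map [::]) // ZtoR_nat (scaled_momentE (k + 4)); first by ring.
by lia.
Qed.

(** The ratios between the actual degrees of freedom and the rows of the
    integer matrix: the constant factor of the parametrization over the common
    denominator. *)
Definition dof_scale (C : R) (o : option (nat * nat)) : R :=
  if o is Some p then area_element R a (inord p.1) / (k.*2 + 2)`!%:R else C / (k + 4)`!%:R.

Definition dof (o : option (nat * nat)) (v : V -> R) : R :=
  if o is Some p then
    triangle_integral (face_vertices a (inord p.1))
      (v * test_fun (inord p.1) (nth [::] (test_exponents k p.1) p.2))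
  else volume_integral tetra v.

Lemma dof_trial_fun : exists2 scale : option (nat * nat) -> R, forall o, scale o != 0 &
  forall x, {in dofs k, forall o, dof o (trial_fun x) =
    scale o * \sum_(s < size (trial_exponents k)) ZtoR R (nth Z0 (dof_row k o) s) * x s}.
Proof.
have fz n : n`!%:R != 0 :> R by rewrite pnatr_eq0 -lt0n fact_gt0.
have [C C0 CE] := volume_moment _ _ a_free _ lamP.
exists (dof_scale C) => [[p|]|x [[i j]|]].
- by rewrite mulf_neq0 ?invr_eq0 //; exact: (area_element_neq0 _ _ a_free _ lamP).
- by rewrite mulf_neq0 ?invr_eq0 // gt_eqF.
- rewrite mem_dofs => /andP[i4 jk] /=.
  by rewrite face_dof ?inordK // mem_nth.
- by move=> _; exact: volume_dof.
Qed.

Hypothesis size_dofs : size (dofs k) = size (trial_exponents k).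
Hypothesis dofs_regular :
  full_column_rank (size (trial_exponents k)) [seq dof_row k o | o <- dofs k].

(** Dividing each equation by its scale turns the conditions into a linear
    system with the integer matrix. *)
Lemma trial_unisolvent (y : option (nat * nat) -> R) :
  exists! x : 'I_(size (trial_exponents k)) -> R,
    {in dofs k, forall o, dof o (trial_fun x) = y o}.
Proof.
have [scale scale0 scaleE] := dof_trial_fun.
pose M : 'M[R]_(size (trial_exponents k)) := \matrix_(i, j)
  ZtoR R (nth Z0 (nth [::] [seq dof_row k o | o <- dofs k] i) j).
have Munit : M \in unitmx.
  apply: full_column_rank_unitmx => //; first by rewrite size_map.
  by move=> r /mapP[[[i j]|] _ ->]; rewrite /= size_map.
have solE x : {in dofs k, forall o, dof o (trial_fun x) = y o} <->
    M *m (\col_s x s) = \col_i (y (nth None (dofs k) i) / scale (nth None (dofs k) i)).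
  split=> [xy|/matrixP Mx o od].
    apply/matrixP => i z; rewrite !mxE.
    have id : nth None (dofs k) i \in dofs k by rewrite mem_nth // size_dofs.
    rewrite -(xy _ id) scaleE // mulrAC divff // mul1r.
    by apply: eq_bigr => s _; rewrite !mxE (nth_map None) // size_dofs.
  have io : (index o (dofs k) < size (trial_exponents k))%N by rewrite -size_dofs index_mem.
  have oE : nth None (dofs k) (Ordinal io) = o by rewrite nth_index.
  have iS : (Ordinal io < size (dofs k))%N by rewrite size_dofs.
  have := Mx (Ordinal io) 0; rewrite !mxE oE => /(congr1 ( *%R (scale o))).
  rewrite [RHS]mulrC divfK // => <-; rewrite scaleE //; congr (_ * _).
  by apply: eq_bigr => s _; rewrite !mxE (nth_map None _ _ iS) oE.
exists (fun s => (invmx M *m (\col_i (y (nth None (dofs k) i) /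
  scale (nth None (dofs k) i)))) s 0); split.
  apply/solE; rewrite -[RHS](mulKVmx Munit); congr (_ *m _).
  by apply/matrixP => s z; rewrite mxE ord1.
move=> x /solE Mx; apply/funext => s.
by rewrite -Mx mulKmx // mxE.
Qed.

End Assembly.

Lemma trial_exponents_wf k : k = 2%N \/ k = 3%N ->
  {in trial_exponents k, forall e, size e = 4 /\ (k <= sumn e <= k.+1)%N}.
Proof.
move=> k23 e ek.
have /allP/(_ _ ek)/andP[/eqP] :
    all (fun e => (size e == 4) && (k <= sumn e <= k.+1)%N) (trial_exponents k).
  by case: k23 => ->; vm_compute.
by [].
Qed.

Lemma size_dofs_trial k : k = 2%N \/ k = 3%N -> size (dofs k) = size (trial_exponents k).
Proof. by case=> ->; vm_compute. Qed.

Lemma dof_matrix_rank k : k = 2%N \/ k = 3%N ->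
  full_column_rank (size (trial_exponents k)) [seq dof_row k o | o <- dofs k].
Proof. by case=> ->; vm_compute. Qed.

Theorem theorem2 (R : realType)
  (a : 'I_4 -> 'rV[R]_3) (a_nondegenerate : nondegenerate_simplex a)
  (lam : 'I_4 -> 'rV[R]_3 -> R) (lam_barycentric : barycentric a lam)
  (k : nat) (k23 : k = 2%N \/ k = 3%N)
  (q : 'I_4 -> seq ('rV[R]_3 -> R))
  (q_basis : forall i : 'I_4,
     is_basis (poly_space k.-1 (conv_hull (face_vertices a i))) (q i))
  (c : forall i : 'I_4, 'I_(size (q i)) -> R) (c0 : R) :
  exists! v : 'rV[R]_3 -> R,
    [/\ poly_minus k.+1 (conv_hull a) lam v,
        forall (i : 'I_4) (j : 'I_(size (q i))),
          triangle_integral (face_vertices a i) (v * (q i)`_j) = c i j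
      & volume_integral (conv_hull a) v = c0].
Proof.
have k_gt0 : (0 < k)%N by case: k23 => ->.
have trial_wf := trial_exponents_wf _ k23.
pose tests (i : 'I_4) := [seq test_fun R a lam i g | g <- test_exponents k i].
have testsE i : lin_span (tests i) = poly_space k.-1 (conv_hull (face_vertices a i)).
  by rewrite (poly_space_faceE _ _ a_nondegenerate _ lam_barycentric).
have /choice[y yE] i := is_basis_transfer _ _ _ _ (c i) (q_basis i) (testsE i).
(* The values of the degrees of freedom on monomials that correspond to the
   prescribed values on the given bases. *)
pose Y (o : option (nat * nat)) := if o is Some p then y (inord p.1) p.2 else c0.
have dofsE x (v := trial_fun R a lam k x) :
    (forall (i : 'I_4) (j : 'I_(size (q i))),
       triangle_integral (face_vertices a i) (v * (q i)`_j) = c i j) /\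
    volume_integral (conv_hull a) v = c0 <->
    {in dofs k, forall o, dof R a lam k o v = Y o}.
  have transfer i := yE i (fun f => triangle_integral (face_vertices a i) (v * f)).
  have {}transfer i : (forall j : 'I_(size (q i)),
        triangle_integral (face_vertices a i) (v * (q i)`_j) = c i j) <->
      (forall j, (j < size (tests i))%N ->
        triangle_integral (face_vertices a i) (v * (tests i)`_j) = y i j).
    apply: transfer => b f g; rewrite -testsE => fW gW.
    rewrite mulrDr fct_scalerAr triangle_integral_lin //;
      exact: (trial_test_integrable _ _ a_nondegenerate _ lam_barycentric).
  have tests_nth (i : 'I_4) j : (j < size (test_exponents k i))%N ->
      (tests i)`_j = test_fun R a lam i (nth [::] (test_exponents k i) j).
    by move=> jk; rewrite (nth_map [::]).
  split=> [[vq v0] [[i j]|]|vY].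
  - rewrite mem_dofs => /andP[i4 jk] /=.
    have {}jk : (j < size (test_exponents k (inord i : 'I_4)))%N by rewrite inordK.
    rewrite -[in test_exponents k i](inordK i4) -tests_nth //.
    by apply: (transfer _).1; [exact: vq|rewrite size_map].
  - by move=> _; exact: v0.
  split; last exact: (vY None (mem_head _ _)).
  move=> i; apply/transfer => j; rewrite size_map => jk; rewrite tests_nth //.
  have := vY (Some (val i, j)); rewrite mem_dofs ltn_ord jk /= inord_val.
  by apply.
have [x [xY x_unique]] := trial_unisolvent _ _ a_nondegenerate _ lam_barycentric _ k_gt0
  trial_wf (size_dofs_trial _ k23) (dof_matrix_rank _ k23) Y.
have trialE v : poly_minus k.+1 (conv_hull a) lam v <->
    exists x', v = trial_fun R a lam k x'.
  by rewrite (poly_minusE _ _ a_nondegenerate _ lam_barycentric) //; exact: lin_span_mapP.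
exists (trial_fun R a lam k x); split.
  by have [vq v0] := (dofsE x).2 xY; split=> //; apply/trialE; exists x.
move=> _ [/trialE[x' ->] vq v0].
by rewrite (x_unique x') //; apply/dofsE.
Qed.
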